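(* Let $(R,\mathfrak{m})$ be a Cohen--Macaulay local ring of prime characteristic $p$ and of dimension $d>0$. Let $H := H^d_{\mathfrak{m}}(R)$ with its natural structure of left $R[x,f]$-module (which is Artinian as an $R$-module), let $m_0$ be the HSL-number of $H$ (the smallest $e\in\mathbb{N}_0$ with $x^e\Gamma_x(H)=0$; such $e$ exists), and let $q_0 := p^{m_0}$. Let $G := H/\Gamma_x(H)$, an $x$-torsion-free left $R[x,f]$-module. Then the set $\mathcal{I}(G)$ of $G$-special $R$-ideals contains a uniquely determined smallest ideal $\mathfrak{b}$ among its members of height at least $1$ (i.e. $\operatorname{height}\mathfrak{b}\ge 1$ and $\mathfrak{b}\subseteq \mathfrak{c}$ for every $\mathfrak{c}\in\mathcal{I}(G)$ of height $\geq 1$). Moreover, for every $c\in\mathfrak{b}\cap R^{\circ}$, the element $c^{q_0}$ is a $q_0$-weak parameter test element for $R$; in particular $R$ has a $q_0$-weak parameter test element. Furthermore the weak parameter test ideal $\sigma'(R)$ satisfies $\mathfrak{b}^{[q_0]}\subseteq \sigma'(R)\subseteq \mathfrak{b}$.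
   Context: $R$ is a commutative Noetherian ring of prime characteristic $p$ (no excellence assumption). $f:R\to R$ is the Frobenius map $r\mapsto r^p$. $R[x,f]$ is the Frobenius skew polynomial ring: as a left $R$-module it is free on $(x^i)_{i\in\mathbb{N}_0}$, with multiplication subject to $xr=r^px$ for $r\in R$; it is graded with $n$-th component $Rx^n$. The graded two-sided ideals of $R[x,f]$ are exactly the sets $\bigoplus_{n}\mathfrak{b}_nx^n$ for ascending chains $(\mathfrak{b}_n)$ of ideals of $R$. For a left $R[x,f]$-module $M$, $\Gamma_x(M)=\{m: x^jm=0 \text{ for some } j\in\mathbb{N}\}$; $M$ is $x$-torsion-free if $xm=0$ implies $m=0$. The graded annihilator $\operatorname{grann}_{R[x,f]}M$ is the set of $\sum_i r_ix^i$ with each $r_ix^i$ annihilating $M$. For an $x$-torsion-free $G$, an ideal $\mathfrak{b}$ of $R$ is $G$-special if there is an $R[x,f]$-submodule $N$ of $G$ with $\operatorname{grann}_{R[x,f]}N=\bigoplus_{n\in\mathbb{N}_0}\mathfrak{b}x^n$; $\mathcal{I}(G)$ denotes the set of these; the ideal $R$ has height $\infty$. The left $R[x,f]$-module structure of $H^d_{\mathfrak{m}}(R)$: representing it as the $d$-th cohomology of the Čech complex on a system of parameters $a_1,\dots,a_d$, one has $x[r/(a_1\cdots a_d)^j]=[r^p/(a_1\cdots a_d)^{jp}]$ (independent of choice of parameters). $R^{\circ}$ is the complement of the union of the minimal primes of $R$; $\mathfrak{a}^{[p^n]}$ is the ideal generated by $p^n$-th powers of elements of $\mathfrak{a}$;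 $r\in\mathfrak{a}^*$ (tight closure) iff there is $c\in R^\circ$ with $cr^{p^n}\in\mathfrak{a}^{[p^n]}$ for all $n\gg0$. A parameter ideal is a proper ideal generated by $\operatorname{height}\mathfrak{a}$ elements. A $p^{w_0}$-weak parameter test element is $c'\in R^\circ$ such that for every parameter ideal $\mathfrak{a}$ and $r\in R$: $r\in\mathfrak{a}^*$ iff $c'r^{p^n}\in\mathfrak{a}^{[p^n]}$ for all $n\ge w_0$. The weak parameter test ideal $\sigma'(R)$ is the ideal generated by $0$ and all $p^{w}$-weak parameter test elements for all $w\in\mathbb{N}_0$. *)

(* Defs.v *)
From HB Require Import structures.
From mathcomp Require Import all_boot all_algebra.
Set Implicit Arguments. Unset Strict Implicit. Unset Printing Implicit Defensive.
Import GRing.Theory.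
Local Open Scope ring_scope.

Section CommAlg.
Variable R : comNzRingType.

Definition ideal_of (I : R -> Prop) :=
  [/\ I 0, (forall x y, I x -> I y -> I (x + y)) & (forall r x, I x -> I (r * x))].

Definition subI (I J : R -> Prop) := forall x, I x -> J x.

Definition gen_by (S : R -> Prop) : R -> Prop := fun x =>
  exists n (g c : 'I_n -> R), (forall i, S (g i)) /\ x = \sum_(i < n) c i * g i.

Definition gen_fam n (g : 'I_n -> R) : R -> Prop := fun x =>
  exists c : 'I_n -> R, x = \sum_(i < n) c i * g i.

Definition prime_ideal (P : R -> Prop) :=
  [/\ ideal_of P, ~ P 1 & forall a b, P (a * b) -> P a \/ P b].

Definition noetherian :=
  forall I : nat -> R -> Prop, (forall n, ideal_of (I n)) ->
    (forall n, subI (I n) (I n.+1)) ->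
    exists N, forall n, (N <= n)%N -> subI (I n) (I N).

Definition local_ring (m : R -> Prop) :=
  [/\ ideal_of m, ~ m 1 & forall I, ideal_of I -> ~ I 1 -> subI I m].

Definition prime_chain n (P : nat -> R -> Prop) :=
  (forall i, (i <= n)%N -> prime_ideal (P i)) /\
  (forall i, (i < n)%N -> subI (P i) (P i.+1) /\ ~ subI (P i.+1) (P i)).

(* height I >= n: every prime containing I has height >= n
   (vacuous for I = R, which thus has height infinity) *)
Definition height_ge (I : R -> Prop) n :=
  forall Q, prime_ideal Q -> subI I Q ->
    exists P, prime_chain n P /\ (forall x, P n x <-> Q x).

Definition height_eq (I : R -> Prop) n := height_ge I n /\ ~ height_ge I n.+1.

Definition krull_dim_eq d :=
  (exists P, prime_chain d P) /\ ~ (exists P, prime_chain d.+1 P).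

Definition minimal_prime (P : R -> Prop) :=
  prime_ideal P /\ forall Q, prime_ideal Q -> subI Q P -> subI P Q.

Definition in_Rcirc (c : R) := forall P, minimal_prime P -> ~ P c.

Definition frob_pow (I : R -> Prop) (q : nat) : R -> Prop :=
  gen_by (fun y => exists x, I x /\ y = x ^+ q).

Variable p : nat.

Definition tight_closure (I : R -> Prop) (r : R) :=
  exists c, in_Rcirc c /\
    exists N, forall n, (N <= n)%N -> frob_pow I (p ^ n) (c * r ^+ (p ^ n)).

Definition parameter_ideal (I : R -> Prop) :=
  [/\ ideal_of I, ~ I 1 &
      exists n, height_eq I n /\
        exists g : 'I_n -> R, forall x, I x <-> gen_fam g x].

Definition weak_ptest (w : nat) (c : R) :=
  in_Rcirc c /\
  forall I, parameter_ideal I -> forall r,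
    tight_closure I r <->
    (forall n, (w <= n)%N -> frob_pow I (p ^ n) (c * r ^+ (p ^ n))).

Definition weak_param_test_ideal : R -> Prop :=
  gen_by (fun c => c = 0 \/ exists w, weak_ptest w c).

Definition sop (m : R -> Prop) (d : nat) (a : 'I_d -> R) :=
  (forall i, m (a i)) /\ (forall x, m x -> exists k, gen_fam a (x ^+ k)).

Definition regular_seq d (a : 'I_d -> R) :=
  forall i : 'I_d, forall r,
    gen_by (fun y => exists j : 'I_d, (j < i)%N /\ y = a j) (r * a i) ->
    gen_by (fun y => exists j : 'I_d, (j < i)%N /\ y = a j) r.

Definition CM_local (m : R -> Prop) d :=
  exists a : 'I_d -> R, sop m a /\ regular_seq a.

(* ---- H = H^d_m(R) as top Cech cohomology on a_1..a_d.
   A pair (r, j) represents the class [r / (a_1 ... a_d)^j]. ---- *)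
Variable d : nat.
Variable a : 'I_d -> R.

Definition Aprod : R := \prod_(i < d) a i.

(* [r / A^j] = 0 in H: r/A^j lies in the image of
   sum_i R_{a_1..^a_i..a_d}, i.e. r/A^j = sum_i s_i/(prod_{t<>i} a_t)^k
   = (sum_i s_i a_i^k)/A^k in R_A. *)
Definition hzero (h : R * nat) :=
  exists k l (s : 'I_d -> R),
    Aprod ^+ l * (h.1 * Aprod ^+ k - (\sum_(i < d) s i * a i ^+ k) * Aprod ^+ h.2) = 0.

Definition hadd (h h' : R * nat) : R * nat :=
  (h.1 * Aprod ^+ h'.2 + h'.1 * Aprod ^+ h.2, (h.2 + h'.2)%N).
Definition hopp (h : R * nat) : R * nat := (- h.1, h.2).
Definition hscale (r : R) (h : R * nat) : R * nat := (r * h.1, h.2).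
Definition hx (h : R * nat) : R * nat := (h.1 ^+ p, (h.2 * p)%N).
Definition hxn (n : nat) (h : R * nat) : R * nat := iter n hx h.

Definition gamma_x (h : R * nat) := exists j, hzero (hxn j h).

Definition HSL_number (e : nat) :=
  (forall h, gamma_x h -> hzero (hxn e h)) /\
  (forall e', (forall h, gamma_x h -> hzero (hxn e' h)) -> (e <= e')%N).

(* G = H / Gamma_x(H): the class of h is zero in G iff h \in Gamma_x(H) *)
Definition gzero (h : R * nat) := gamma_x h.
Definition gequiv (h h' : R * nat) := gzero (hadd h (hopp h')).

(* R[x,f]-submodules of G, represented by saturated predicates on
   representatives *)
Definition G_submodule (N : R * nat -> Prop) :=
  [/\ forall h h', gequiv h h' -> N h -> N h',
      N (0, 0%N),
      forall h h', N h -> N h' -> N (hadd h h'),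
      forall r h, N h -> N (hscale r h) &
      forall h, N h -> N (hx h)].

(* b is G-special: grann N = (+)_n b x^n for some submodule N, i.e. for
   every n, {r | r x^n N = 0} = b *)
Definition G_special (b : R -> Prop) :=
  exists N, G_submodule N /\
    forall (n : nat) (r : R), b r <-> (forall h, N h -> gzero (hscale r (hxn n h))).

End CommAlg.

(* Main.v *)
Require Import Defs.
From HB Require Import structures.
From mathcomp Require Import all_boot all_algebra.
From mathcomp Require Import boolp ring.
Import GRing.Theory.
Local Open Scope ring_scope.
Set Implicit Arguments. Unset Strict Implicit. Unset Printing Implicit Defensive.

(** H is the quotient of R[X] in which r X^j represents [r / (a_1...a_d)^j]; there x is the
    p-th power map, and H is Artinian because its socle is finitely generated (Kirby).
    Let T be the set of classes of H killed, modulo the nilpotent part Gamma and after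
    every power of x, by one element of R°. The ideal b is the annihilator of T modulo Gamma.

    Among the graded annihilators of elements of T/Gamma the maximal ones are prime, each
    meets R°, and they are finitely many by the descending chain condition. Replacing Gamma
    by the elements annihilated by their intersection makes these primes strictly smaller,
    so finite dimension stops the process, and a product of elements of R° lies in b.

    If s is any system of parameters, suitable exchanges of one parameter at a time connect
    s to (a_1^k, ..., a_d^k), and produce D in R such that for q = p^n
    r in (s^q) iff D^q r in (a_1^kq, ..., a_d^kq). Thus r |-> [D r / (a_1...a_d)^k] turns
    tight closure of (s) into membership in T, and b into test elements; a parameter ideal
    of smaller height is an intersection of full ones by Krull's theorem. *)

(** The element of R° that puts a class into T varies with the class; the counting of primes is
    there to find one element that serves all of T, and that element shows that b has height at
    least 1. Minimality of b: a special ideal of height at least 1 contains some element of R°, so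
    the submodule that it annihilates lies in T/Gamma and is killed by b. The power q_0 is the price
    of passing from Gamma to 0: if c x^k h lies in Gamma, then x^(m_0) sends it to 0, which reads
    c^(q_0) x^(k+m_0) h = 0. This gives both the exponent of c and the bound n >= m_0. For the upper
    bound on sigma', a weak test element is applied to the ideals (a_1^j, ..., a_d^j) at one
    exponent only, since membership in Gamma descends from c x^n h to c h. For the lower bound, an
    element x of b that may lie outside R° is written (x + y) - y with x + y in R° and y a multiple
    of an element of b in R°; Frobenius is additive. One D has to serve every q. Exchanges of
    parameters are therefore recorded as congruences w = D b modulo the other parameters, which
    Frobenius preserves. *)

Lemma dependent_choice (T : Type) (F : T -> Prop) (lt : T -> T -> Prop) :
  (exists x, F x) -> (forall x, F x -> exists y, F y /\ lt x y) ->
  exists u : nat -> T, forall n, F (u n) /\ lt (u n) (u n.+1).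
Proof.
move=> [x0 Fx0] step.
have [f fP] : {f : {x | F x} -> {x | F x} & forall x, lt (sval x) (sval (f x))}.
  by apply: (choice (P := fun x y => lt (sval x) (sval y))) => -[x Fx];
     have [y [Fy ltxy]] := step x Fx; exists (exist _ y Fy).
exists (fun n => sval (iter n f (exist _ x0 Fx0))) => n; split; first exact: svalP.
exact: fP.
Qed.

(** * Ideals of a commutative Noetherian ring *)

Section Ideals.
Variable R : comNzRingType.
Implicit Types (I J K P Q : R -> Prop) (s t u : seq R).

Lemma ideal0 I : ideal_of I -> I 0. Proof. by case. Qed.
Lemma idealD I x y : ideal_of I -> I x -> I y -> I (x + y).
Proof. by case=> _ h _; apply: h. Qed.
Lemma ideal_mull I r x : ideal_of I -> I x -> I (r * x).
Proof. by case=> _ _ h; apply: h. Qed.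
Lemma ideal_mulr I r x : ideal_of I -> I x -> I (x * r).
Proof. by rewrite mulrC; apply: ideal_mull. Qed.
Lemma idealN I x : ideal_of I -> I x -> I (- x).
Proof. by move=> hI Ix; rewrite -mulN1r; apply: ideal_mull. Qed.
Lemma idealB I x y : ideal_of I -> I x -> I y -> I (x - y).
Proof. by move=> hI Ix Iy; apply: idealD => //; apply: idealN. Qed.
Lemma ideal_diff I x y : ideal_of I -> I (x - y) -> I y -> I x.
Proof. by move=> hI h Iy; rewrite -(subrK y x); apply: idealD. Qed.
Lemma ideal_sum I (T : Type) (r : seq T) (Pr : pred T) (F : T -> R) :
  ideal_of I -> (forall i, Pr i -> I (F i)) -> I (\sum_(i <- r | Pr i) F i).
Proof.
move=> hI h; elim/big_ind: _ => //; first exact: ideal0.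
by move=> *; apply: idealD.
Qed.
Lemma idealX I x n : ideal_of I -> (0 < n)%N -> I x -> I (x ^+ n).
Proof. by move=> hI; case: n => // n _ Ix; rewrite exprS; apply: ideal_mulr. Qed.

Lemma subI_anti I J : subI I J -> subI J I -> I = J.
Proof. by move=> h1 h2; apply/predeqP => x; split; [apply: h1 | apply: h2]. Qed.

Lemma prime_ideal_of P : prime_ideal P -> ideal_of P. Proof. by case. Qed.
Lemma prime_not1 P : prime_ideal P -> ~ P 1. Proof. by case. Qed.
Lemma primeM P a b : prime_ideal P -> P (a * b) -> P a \/ P b.
Proof. by case=> _ _ h; apply: h. Qed.
Lemma primeX P x n : prime_ideal P -> P (x ^+ n) -> P x.
Proof.
move=> hP; elim: n => [|n IH]; first by move/(prime_not1 hP).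
by rewrite exprS => /(primeM hP) [].
Qed.

Definition zero_ideal : R -> Prop := fun x => x = 0.
Lemma ideal_zero : ideal_of zero_ideal.
Proof.
split=> // [x y -> ->|r x ->]; rewrite /zero_ideal ?addr0 ?mulr0 //.
Qed.

Definition addgen J y : R -> Prop := fun x => exists r, J (x - r * y).
(** Adding generators one at a time over a variable base [J] matches the recursion of [reg], where
    each element is tested modulo the preceding ones. *)
Fixpoint idl J s : R -> Prop := if s is y :: s' then idl (addgen J y) s' else J.

Lemma ideal_addgen J y : ideal_of J -> ideal_of (addgen J y).
Proof.
move=> hJ; split=> [|a b [r ra] [r' rb]|c a [r ra]].
- by exists 0; rewrite mul0r subr0; apply: ideal0.
- exists (r + r'); have -> : a + b - (r + r') * y = (a - r * y) + (b - r' * y) by ring.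
  exact: idealD.
- exists (c * r); have -> : c * a - c * r * y = c * (a - r * y) by ring.
  exact: ideal_mull.
Qed.
Lemma addgen_base J y : ideal_of J -> subI J (addgen J y).
Proof. by move=> hJ x Jx; exists 0; rewrite mul0r subr0. Qed.
Lemma addgen_gen J y : ideal_of J -> addgen J y y.
Proof. by move=> hJ; exists 1; rewrite mul1r subrr; apply: ideal0. Qed.
Lemma addgen_le J y K : ideal_of K -> subI J K -> K y -> subI (addgen J y) K.
Proof.
by move=> hK JK Ky x [r /JK]; move/(ideal_diff hK); apply; apply: ideal_mull.
Qed.

Lemma ideal_idl J s : ideal_of J -> ideal_of (idl J s).
Proof. by elim: s J => //= y s IH J hJ; apply: IH; apply: ideal_addgen. Qed.
Lemma idl_base J s : ideal_of J -> subI J (idl J s).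
Proof.
elim: s J => [|y s IH] J hJ x // Jx.
by apply: (IH _ (ideal_addgen y hJ)); apply: addgen_base.
Qed.
Lemma idl_gen J s y : ideal_of J -> y \in s -> idl J s y.
Proof.
elim: s J => //= z s IH J hJ; rewrite inE => /orP[/eqP->|ys]; last first.
  by apply: IH => //; apply: ideal_addgen.
by apply: (idl_base _ (ideal_addgen z hJ)); apply: addgen_gen.
Qed.
Lemma idl_le J s K : ideal_of K -> subI J K -> (forall y, y \in s -> K y) ->
  subI (idl J s) K.
Proof.
move=> hK; elim: s J => //= z s IH J JK sK; apply: IH.
  by apply: addgen_le => //; apply: sK; rewrite mem_head.
by move=> y ys; apply: sK; rewrite inE ys orbT.
Qed.
Lemma idl_cat J s t : idl J (s ++ t) = idl (idl J s) t.
Proof. by elim: s J => //= y s IH J. Qed.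
Lemma idl_rcons J s y : idl J (rcons s y) = addgen (idl J s) y.
Proof. by rewrite -cats1 idl_cat. Qed.
Lemma idl_mono J s t : ideal_of J -> {subset s <= t} -> subI (idl J s) (idl J t).
Proof.
move=> hJ st; apply: idl_le; [exact: ideal_idl | exact: idl_base |].
by move=> y /st; apply: idl_gen.
Qed.
Lemma idl_eqi J s t : ideal_of J -> s =i t -> idl J s = idl J t.
Proof.
by move=> hJ st; apply: subI_anti; apply: idl_mono => // x; rewrite st.
Qed.
Lemma idl_cons J s y : ideal_of J -> idl J (y :: s) = addgen (idl J s) y.
Proof.
by move=> hJ; rewrite -idl_rcons; apply: idl_eqi => // x; rewrite mem_rcons.
Qed.

Definition mprimary (m I : R -> Prop) := forall x, m x -> exists k, I (x ^+ k).

Lemma mprimary_prime m I P : mprimary m I -> prime_ideal P -> subI I P -> subI m P.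
Proof. by move=> hI hP IP x /hI[k /IP]; apply: primeX. Qed.

Section Noetherian.
Hypothesis noethR : noetherian R.

Lemma noeth_max (F : (R -> Prop) -> Prop) :
  (forall I, F I -> ideal_of I) -> (exists I, F I) ->
  exists I, F I /\ forall J, F J -> subI I J -> subI J I.
Proof.
move=> Fid exF; apply: contrapT => nmax.
have [I FI|u uP] := dependent_choice (lt := fun I J => subI I J /\ ~ subI J I) exF.
  apply: contrapT => h; apply: nmax; exists I; split=> // J FJ IJ.
  by apply: contrapT => nJI; apply: h; exists J.
have [N NP] := noethR (fun n => Fid _ (uP n).1) (fun n => (uP n).2.1).
by case: (uP N) => _ [_]; apply; apply: NP.
Qed.

Lemma noeth_fg I : ideal_of I ->
  exists s, (forall y, y \in s -> I y) /\ subI I (idl zero_ideal s).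
Proof.
move=> hI.
have [||J [[s [sI ->]] Jmax]] := @noeth_max (fun J => exists s, (forall y, y \in s -> I y)
   /\ J = idl zero_ideal s).
- by move=> J [s [_ ->]]; apply: ideal_idl; apply: ideal_zero.
- by exists (idl zero_ideal [::]), [::].
exists s; split=> // x Ix.
apply: (Jmax (idl zero_ideal (x :: s))).
- by exists (x :: s); split=> // y; rewrite inE => /orP[/eqP->|/sI].
- by apply: idl_mono => [|y ys]; [exact: ideal_zero | rewrite inE ys orbT].
- by apply: idl_gen; [exact: ideal_zero | rewrite mem_head].
Qed.

(** Noetherian induction: a maximal counterexample [J] is not prime, so some product [a * b] in [J]
    has both factors outside, and the lists for [J + (a)] and [J + (b)] together serve [J]. *)
Lemma minimal_primes I : ideal_of I ->
  exists Ps : seq (R -> Prop), (forall P, P \in Ps -> prime_ideal P /\ subI I P) /\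
    forall Q, prime_ideal Q -> subI I Q -> exists2 P, P \in Ps & subI P Q.
Proof.
move=> hI; apply: contrapT => nI.
pose C J := exists Ps : seq (R -> Prop), (forall P, P \in Ps -> prime_ideal P /\ subI J P) /\
    forall Q, prime_ideal Q -> subI J Q -> exists2 P, P \in Ps & subI P Q.
have [||J [[hJ nJ] Jmax]] := @noeth_max (fun J => ideal_of J /\ ~ C J).
- by move=> J [].
- by exists I.
have big a : ~ J a -> C (addgen J a).
  move=> nJa; apply: contrapT => nC; apply: nJa; apply: (Jmax (addgen J a)).
  - by split=> //; apply: ideal_addgen.
  - exact: addgen_base.
  - exact: addgen_gen.
have J1 : ~ J 1.
  move=> J1; apply: nJ; exists [::]; split=> // Q hQ JQ.
  by case: (prime_not1 hQ); apply: JQ.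
have [hP|] := EM (prime_ideal J).
  apply: nJ; exists [:: J]; split=> [P|Q hQ JQ]; first by rewrite inE => /eqP->; split.
  by exists J => //; rewrite inE.
apply; split=> // a b Jab; apply: contrapT => /not_orP[/big[Ps [Ps1 Ps2]] /big[Qs [Qs1 Qs2]]].
apply: nJ; exists (Ps ++ Qs); split=> [P|Q hQ JQ].
  rewrite mem_cat => /orP[/Ps1|/Qs1] [hP sP]; split=> // x Jx; apply: sP; exact: addgen_base.
have [Qa|Qb] := primeM hQ (JQ _ Jab).
  have [|P PP PQ] := Ps2 Q hQ; first by apply: addgen_le => //; apply: prime_ideal_of.
  by exists P; rewrite // mem_cat PP.
have [|P PP PQ] := Qs2 Q hQ; first by apply: addgen_le => //; apply: prime_ideal_of.
by exists P; rewrite // mem_cat PP orbT.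
Qed.

(** Prime avoidance inside the coset [a + I]: only the primes containing both [a] and [I] are
    unavoidable. The list may contain comparable primes. *)
Lemma coset_avoidance (Ps : seq (R -> Prop)) I (a : R) :
  (forall P, P \in Ps -> prime_ideal P) -> ideal_of I ->
  exists2 y, I y & forall P, P \in Ps -> P (a + y) -> P a /\ subI I P.
Proof.
move=> + hI; elim: Ps => [_|P Ps IH hPs].
  by exists 0 => //; apply: ideal0.
have hP : prime_ideal P by apply: hPs; rewrite mem_head.
have idP := prime_ideal_of hP.
have [|y Iy yP] := IH; first by move=> Q QPs; apply: hPs; rewrite inE QPs orbT.
have [done|] := EM (P (a + y) -> P a /\ subI I P).
  by exists y => // Q; rewrite inE => /orP[/eqP->|] //; apply: yP.
move/not_implyP=> [Pw nP].
have nIP : ~ subI I P.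
  move=> IP; apply: nP; split=> //.
  by rewrite -(addrK y a); apply: idealB => //; apply: IP.
(* Adding [z] repairs [P] without spoiling the other primes: a [Q] containing [z] sees no change,
   and a [Q] inside [P] is avoided as soon as [P] is. *)
have [z Iz [nPz zP]] : exists2 z, I z & ~ P z /\ forall Q, Q \in Ps -> subI Q P \/ Q z.
  have : forall Q, Q \in Ps -> ideal_of Q.
    by move=> Q QPs; apply: prime_ideal_of; apply: hPs; rewrite inE QPs orbT.
  elim: (Ps) => [_|Q Qs IHQ hQs].
    apply: contrapT => h; apply: nIP => x Ix; apply: contrapT => nPx; apply: h.
    by exists x.
  have [|z Iz [nPz zP]] := IHQ; first by move=> Q' h'; apply: hQs; rewrite inE h' orbT.
  have hQ : ideal_of Q by apply: hQs; rewrite mem_head.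
  have [QP|] := EM (subI Q P).
    by exists z => //; split=> // Q'; rewrite inE => /orP[/eqP->|/zP] //; left.
  move/existsNP=> [q /not_implyP[Qq nPq]].
  exists (q * z); first exact: ideal_mull.
  split=> [/(primeM hP)[]|Q'] //; rewrite inE => /orP[/eqP->|Q'Qs].
    by right; apply: ideal_mulr.
  have [|Q'z] := zP _ Q'Qs; first by left.
  right; apply: ideal_mull => //; apply: hQs; by rewrite inE Q'Qs orbT.
exists (y + z) => [|Q]; first exact: idealD.
have nPw : ~ P (a + (y + z)).
  move=> h; apply: nPz; have -> : z = a + (y + z) - (a + y) by ring.
  exact: idealB.
rewrite inE => /orP[/eqP-> //|QPs Qw].
have [QP|Qz] := zP Q QPs; first by case: nPw; apply: QP.
apply: yP => //; have -> : a + y = a + (y + z) - z by ring.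
by apply: idealB => //; apply: prime_ideal_of; apply: hPs; rewrite inE QPs orbT.
Qed.

(** An ideal over [I] maximal among those missing every power of [x] is prime, hence contains [m]
    and with it [x]. *)
Lemma mprimary_of_primes m I : ideal_of I ->
  (forall P, prime_ideal P -> subI I P -> subI m P) -> mprimary m I.
Proof.
move=> hI h x mx; apply: contrapT => nx.
have [||P [[hP IP nP] Pmax]] := @noeth_max (fun P => [/\ ideal_of P, subI I P & ~ exists k, P (x ^+ k)]).
- by move=> P [].
- by exists I; split.
have big a : ~ P a -> exists k, addgen P a (x ^+ k).
  move=> nPa; apply: contrapT => nC; apply: nPa; apply: (Pmax (addgen P a)).
  - split=> //; first exact: ideal_addgen.
    by move=> y /IP; apply: addgen_base.
  - exact: addgen_base.
  - exact: addgen_gen.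
have prP : prime_ideal P.
  split=> // [P1|a b Pab]; first by apply: nP; exists 0%N.
  apply: contrapT => /not_orP[/big[i [r ri]] /big[j [r' rj]]]; apply: nP; exists (i + j)%N.
  have -> : x ^+ (i + j) = x ^+ j * (x ^+ i - r * a) + r * a * (x ^+ j - r' * b)
     + r * r' * (a * b) by rewrite exprD; ring.
  by apply: idealD => //; first apply: idealD => //; apply: ideal_mull.
by apply: nP; exists 1%N; rewrite expr1; apply: (h P).
Qed.

Lemma ideal_leqX I y n k : ideal_of I -> (n <= k)%N -> I (y ^+ n) -> I (y ^+ k).
Proof. by move=> hI nk h; rewrite -(subnK nk) exprD; apply: ideal_mull. Qed.

Lemma common_exponent I s : ideal_of I -> (forall y, y \in s -> exists k, I (y ^+ k)) ->
  exists k, forall y, y \in s -> I (y ^+ k).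
Proof.
move=> hI; elim: s => [|y s IH] h; first by exists 0%N.
have [|k kP] := IH; first by move=> z zs; apply: h; rewrite inE zs orbT.
have [|l lP] := h y; first by rewrite mem_head.
exists (k + l)%N => z; rewrite inE => /orP[/eqP->|/kP h'].
  by apply: ideal_leqX lP; rewrite ?leq_addl.
by apply: ideal_leqX h'; rewrite ?leq_addr.
Qed.

(** * Local rings and Krull's intersection theorem *)

Section Local.
Variable m : R -> Prop.
Hypothesis locm : local_ring m.

Lemma ideal_m : ideal_of m. Proof. by case: locm. Qed.
Lemma m_not1 : ~ m 1. Proof. by case: locm. Qed.
Lemma proper_sub_m I : ideal_of I -> ~ I 1 -> subI I m.
Proof. by case: locm => _ _; apply. Qed.
Lemma unit_not_m x : ~ m x -> exists y, y * x = 1.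
Proof.
move=> nmx; apply: contrapT => nu; apply: nmx.
apply: (proper_sub_m (ideal_addgen x ideal_zero)); last exact/addgen_gen/ideal_zero.
by move=> [r h]; apply: nu; exists r; apply/esym/eqP; rewrite -subr_eq0; apply/eqP.
Qed.
Lemma unit_1subm x : m x -> exists y, y * (1 - x) = 1.
Proof.
move=> mx; apply: unit_not_m => h; apply: m_not1; rewrite -(subrK x 1).
exact: (idealD ideal_m).
Qed.
Lemma ideal_1subm I x z : ideal_of I -> m x -> I ((1 - x) * z) -> I z.
Proof.
move=> hI mx h; have [y yP] := unit_1subm mx.
by rewrite -(mul1r z) -yP -mulrA; apply: ideal_mull.
Qed.
Lemma prime_m : prime_ideal m.
Proof.
split; [exact: ideal_m | exact: m_not1 | move=> a b mab].
apply: contrapT => /not_orP[/unit_not_m[x xP] /unit_not_m[y yP]]; apply: m_not1.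
have -> : 1 = x * y * (a * b) by rewrite -[1]mulr1 -{1}xP -yP; ring.
by apply: ideal_mull => //; apply: ideal_m.
Qed.
Lemma prime_sub_m P : prime_ideal P -> subI P m.
Proof. by move=> hP; apply: proper_sub_m; [exact: prime_ideal_of | exact: prime_not1]. Qed.

(* With M the intersection and J' maximal among the ideals over J not containing M,
   one gets m M <= J'; a K maximal with K /\ M <= J' then contains a power of each
   generator, hence M. *)
Lemma krull_intersection J s x : ideal_of J -> (forall y, y \in s -> m y) ->
  (forall k, idl J [seq y ^+ k | y <- s] x) -> J x.
Proof.
move=> hJ sm; pose M x := forall k, idl J [seq y ^+ k | y <- s] x.
rewrite -/(M x) => Mx; apply: contrapT => nJx.
have hM : ideal_of M.
  split=> [k|a b Ma Mb k|r a Ma k].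
  - by apply: ideal0; apply: ideal_idl.
  - by apply: idealD; [exact: ideal_idl | exact: Ma | exact: Mb].
  - by apply: ideal_mull; [exact: ideal_idl | exact: Ma].
have [||J' [[hJ' JJ' nMJ'] J'max]] :=
  @noeth_max (fun I => [/\ ideal_of I, subI J I & ~ subI M I]).
- by move=> I [].
- by exists J; split=> // MJ; apply/nJx/MJ.
have mM y z : m y -> M z -> J' (y * z).
  move=> my Mz; have [|nJz] := EM (J' z); first exact: ideal_mull.
  apply: (J'max (addgen J' (y * z))); last exact: addgen_gen.
    split; first exact: ideal_addgen.
      by move=> a /JJ'; apply: addgen_base.
    move/(_ z Mz) => [r h]; apply: nJz.
    apply: (@ideal_1subm _ (r * y)) => //; first by apply: ideal_mull; first exact: ideal_m.
    by have -> : (1 - r * y) * z = z - r * (y * z) by ring.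
  exact: addgen_base.
have [||K [[hK J'K KM] Kmax]] := @noeth_max (fun I => [/\ ideal_of I, subI J' I &
   forall z, I z -> M z -> J' z]).
- by move=> I [].
- by exists J'; split.
have [k kP] : exists k, forall y, y \in s -> K (y ^+ k).
  apply: common_exponent => // y ys.
  (* The colons [K : y^n] stabilize. If [z] in [M] is [r * y ^+ n] modulo [K], then [y * z] in [K]
     gives [r * y ^+ n.+1] in [K], hence already [r * y ^+ n] and [z]; so [y ^+ n] can be added to
     [K]. *)
  have [||n nP] := noethR (I := fun n z => K (z * y ^+ n)).
  - move=> n; split=> [|a b Ka Kb|r a Ka]; rewrite ?mul0r ?mulrDl -?mulrA.
    + exact: ideal0.
    + exact: idealD.
    + exact: ideal_mull.
  - by move=> n z Kz; rewrite exprSr mulrA; apply: ideal_mulr.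
  exists n; apply: (Kmax (addgen K (y ^+ n))); last exact: addgen_gen; last exact: addgen_base.
  split; first exact: ideal_addgen.
    by move=> z /J'K; apply: addgen_base.
  move=> z [r Kz] Mz; apply: KM => //; apply: (ideal_diff hK Kz).
  apply: (nP n.+1) => //; have /(J'K) Kyz := mM y z (sm y ys) Mz.
  have -> : r * y ^+ n.+1 = y * z - y * (z - r * y ^+ n) by rewrite exprS; ring.
  by apply: idealB => //; apply: ideal_mull.
apply: nMJ' => z Mz; apply: KM => //; move: (Mz k); apply: idl_le => //.
  by move=> a /JJ'/J'K.
by move=> _ /mapP[y ys ->]; apply: kP.
Qed.

Lemma krull_intersection1 J y x : ideal_of J -> m y ->
  (forall k, addgen J (y ^+ k) x) -> J x.
Proof.
move=> hJ my h; apply: (@krull_intersection J [:: y]) => // z.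
by rewrite inE => /eqP->.
Qed.

End Local.
End Noetherian.
End Ideals.

(** * Artinian modules *)

Section Chains.
Variables (R : comNzRingType) (V : lmodType R).
Implicit Types (Z B M : V -> Prop) (C : nat -> V -> Prop).

Definition submod M :=
  [/\ M 0, forall u v, M u -> M v -> M (u + v) & forall (r : R) v, M v -> M (r *: v)].

Lemma submod0 M : submod M -> M 0. Proof. by case. Qed.
Lemma submodD M u v : submod M -> M u -> M v -> M (u + v).
Proof. by case=> _ h _; apply: h. Qed.
Lemma submodZ M (r : R) v : submod M -> M v -> M (r *: v).
Proof. by case=> _ _ h; apply: h. Qed.
Lemma submodN M v : submod M -> M v -> M (- v).
Proof. by move=> hN Nv; rewrite -scaleN1r; apply: submodZ. Qed.
Lemma submodB M u v : submod M -> M u -> M v -> M (u - v).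
Proof. by move=> hN Nu Nv; apply: submodD => //; apply: submodN. Qed.
Lemma submod_diff M u v : submod M -> M (u - v) -> M v -> M u.
Proof. by move=> hN h Nv; rewrite -(subrK v u); apply: submodD. Qed.
Lemma submod_diffr M u v : submod M -> M (u - v) -> M u -> M v.
Proof. by move=> hN h Nu; rewrite -(subKr u v); apply: submodB. Qed.
Lemma submod_sum M k (F : nat -> V) : submod M -> (forall i, (i < k)%N -> M (F i)) ->
  M (\sum_(i < k) F i).
Proof.
move=> hN h; elim/big_ind: _ => [|u v|i _]; [exact: submod0 | exact: submodD |].
exact: h.
Qed.

(** The chain condition on [B / Z] is expressed through submodules lying between [Z] and [B], so
    that no quotient module has to be formed. *)
Definition artin_between B Z := forall C, (forall n, submod (C n)) ->
  (forall n v, Z v -> C n v) -> (forall n v, C n v -> B v) ->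
  (forall n v, C n.+1 v -> C n v) ->
  exists N, forall n, (N <= n)%N -> forall v, C N v -> C n v.

Definition noeth_between B Z := forall C, (forall n, submod (C n)) ->
  (forall n v, Z v -> C n v) -> (forall n v, C n v -> B v) ->
  (forall n v, C n v -> C n.+1 v) ->
  exists N, forall n, (N <= n)%N -> forall v, C n v -> C N v.

Lemma descending_le C i j v : (forall n v, C n.+1 v -> C n v) -> (i <= j)%N -> C j v -> C i v.
Proof.
move=> hC /subnK <-; elim: (j - i)%N => // k IH; rewrite addSn => /hC; exact: IH.
Qed.

(* Kirby: a submodule C of a y-torsion module is determined by the submodules
   y^n (C /\ (0 : y^(n+1))) of (0 : y), which decrease with n. *)
Lemma artin_torsion Z B (y : R) : submod Z -> submod B ->
  (forall v, B v -> exists n, Z (y ^+ n *: v)) ->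
  artin_between (fun v => B v /\ Z (y *: v)) Z -> artin_between B Z.
Proof.
move=> hZ hB tors art C hC ZC CB Cdec.
pose F k n v := exists u, [/\ C k u, Z (y ^+ n.+1 *: u) & Z (v - y ^+ n *: u)].
have Fsub k n : submod (F k n).
  split=> [|a b [u [Cu Zu ha]] [u' [Cu' Zu' hb]]|r a [u [Cu Zu ha]]].
  - exists 0; rewrite !scaler0 subr0; split=> //; exact: submod0.
  - exists (u + u'); split; [exact: submodD | by rewrite scalerDr; apply: submodD |].
    by rewrite scalerDr opprD addrACA; apply: submodD.
  - exists (r *: u); split; first exact: submodZ.
      by rewrite scalerA mulrC -scalerA; apply: submodZ.
    by rewrite scalerA mulrC -scalerA -scalerBr; apply: submodZ.
have ZF k n v : Z v -> F k n v.
  move=> Zv; exists 0; rewrite !scaler0 subr0; split=> //; exact: submod0.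
have FB k n v : F k n v -> B v /\ Z (y *: v).
  move=> [u [Cu Zu hv]]; split.
    apply: (submod_diff hB) (submodZ (y ^+ n) hB (CB _ _ Cu)).
    by apply: (CB k); apply: ZC.
  apply: (submod_diff hZ (v := y *: (y ^+ n *: u))).
    by rewrite -scalerBr; apply: submodZ.
  by rewrite scalerA -exprS.
have Fk k n v : F k.+1 n v -> F k n v.
  by move=> [u [Cu Zu hv]]; exists u; split=> //; apply: Cdec.
have Fn k n v : F k n.+1 v -> F k n v.
  move=> [u [Cu Zu hv]]; exists (y *: u); split; first exact: submodZ.
    by rewrite scalerA -exprSr.
  by rewrite scalerA -exprSr.
have Fle k n k' n' v : (k <= k')%N -> (n <= n')%N -> F k' n' v -> F k n v.
  move=> kk nn h; apply: (descending_le (C := fun k => F k n)) kk _; first by move=> *; apply: Fk.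
  by apply: (descending_le (C := F k')) nn h; move=> *; apply: Fn.
have [N NP] : exists N, forall n, (N <= n)%N -> forall v, F N N v -> F n n v.
  by apply: (art (fun n => F n n)) => [n|n v|n v|n v]; [| exact: ZF | exact: FB | exact: Fle].
have [K KP] : {K : nat -> nat & forall n k, (K n <= k)%N -> forall v, F (K n) n v -> F k n v}.
  apply: (choice (P := fun n K => forall k, (K <= k)%N -> forall v, F K n v -> F k n v)) => n.
  by apply: (art (fun k => F k n)) => [k|k v|k v|k v]; [| exact: ZF | exact: FB | exact: Fk].
(* The diagonal index [N] controls all [n >= N]; each of the finitely many [n < N] has its own bound
   [K n], and the sum dominates them all. *)
pose M := (N + \sum_(i < N) K i)%N.
have MP k n v : (M <= k)%N -> F M n v -> F k n v.
  move=> Mk h; have [Nn|nN] := leqP N n.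
    apply: (Fle k n (maxn k n) (maxn k n)); rewrite ?leq_maxl ?leq_maxr //.
    apply: NP; first by rewrite leq_max Nn orbT.
    by apply: Fle h; rewrite // /M leq_addr.
  have KM : (K n <= M)%N.
    by rewrite /M (bigD1 (Ordinal nN)) //= addnCA leq_addr.
  apply: KP; first exact: leq_trans Mk.
  exact: Fle h.
exists M => k Mk v CMv.
have [e Ze] := tors v (CB _ _ CMv).
elim: e v CMv Ze => [|e IH] v CMv; first by rewrite expr0 scale1r; apply: ZC.
move=> Ze; have [||u [Cu Zu hu]] := MP k e (y ^+ e *: v) => //.
  by exists v; split=> //; rewrite subrr; apply: submod0.
apply: (submod_diff (hC k) _ Cu); apply: IH; last by rewrite scalerBr.
by apply: submodB => //; apply: descending_le Mk Cu.
Qed.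

(** * From a finitely generated socle to the descending chain condition *)

Section Socle.
Variable m : R -> Prop.
Hypothesis locm : local_ring m.

(** [B / Z] is a vector space over the residue field. Vectors chosen in the successive gaps of a
    strictly descending chain are independent, so their spans would ascend for ever. *)
Lemma artin_of_noeth_socle Z B : submod Z ->
  (forall y v, m y -> B v -> Z (y *: v)) -> noeth_between B Z -> artin_between B Z.
Proof.
move=> hZ mB noeB C hC ZC CB Cdec; apply: contrapT => nstab.
have [g gP] : {g : nat -> nat * V & forall N,
    [/\ (N <= (g N).1)%N, C N (g N).2 & ~ C (g N).1 (g N).2]}.
  apply: (choice (P := fun N (nv : nat * V) => [/\ (N <= nv.1)%N, C N nv.2 & ~ C nv.1 nv.2])) => N.
  apply: contrapT => h; apply: nstab; exists N => n Nn v CNv; apply: contrapT => nCv.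
  by apply: h; exists (n, v).
pose f i := iter i (fun N => (g N).1) 0%N; pose v i := (g (f i)).2.
have fle i j : (i <= j)%N -> (f i <= f j)%N.
  move=> /subnK <-; elim: (j - i)%N => // k IH; apply: leq_trans IH _.
  by have [] := gP (f (k + i)%N).
have Cv i j : (i <= j)%N -> C (f i) (v j).
  by move=> ij; apply: descending_le (fle _ _ ij) _ => //; have [] := gP (f j).
have nCv i : ~ C (f i.+1) (v i) by have [] := gP (f i).
(* The later vectors lie in [C (f i.+1)], so a unit coefficient would put [v i] there too. Once the
   leading coefficient is in [m], its term lies in [Z] and is dropped. *)
have coefm l i (b : nat -> R) : Z (\sum_(j < l) b j *: v (i + j)%N) ->
    forall j, (j < l)%N -> m (b j).
  elim: l i b => // l IH i b; rewrite big_ord_recl /= addn0 => Zs.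
  have Cs : C (f i.+1) (\sum_(j < l) b j.+1 *: v (i + j.+1)%N).
    apply: (submod_sum (F := fun j => b j.+1 *: v (i + j.+1)%N)) => // j _.
    by apply: submodZ => //; apply: Cv; rewrite addnS ltnS leq_addr.
  have Cb : C (f i.+1) (b 0%N *: v i).
    rewrite -(addrK (\sum_(j < l) b j.+1 *: v (i + j.+1)%N) (b 0%N *: v i)).
    by apply: submodB => //; apply: ZC.
  have mb0 : m (b 0%N).
    apply: contrapT => /(unit_not_m locm)[c cb]; apply: (@nCv i).
    by rewrite -(scale1r (v i)) -cb -scalerA; apply: submodZ.
  case=> [|j] //; rewrite ltnS => jl; apply: (IH i.+1 (fun j => b j.+1)) => //.
  rewrite -(addKr (b 0%N *: v i) (\sum_(j < l) _)); apply: submodD => //.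
    by apply: submodN => //; apply: mB => //; apply: (CB (f i)); apply: Cv.
  by rewrite (eq_bigr (fun j : 'I_l => b j.+1 *: v (i + j.+1)%N)) // => k _; rewrite addSnnS.
pose S i w := exists c : nat -> R, Z (w - \sum_(j < i) c j *: v j).
have [||||N NP] := noeB S.
- move=> n; split=> [|a b [c ha] [c' hb]|r a [c ha]].
  + by exists (fun=> 0); rewrite big1 => [|j _]; rewrite ?scale0r // subr0; apply: submod0.
  + exists (fun j => c j + c' j).
    rewrite (eq_bigr (fun j : 'I_n => c j *: v j + c' j *: v j)) => [|j _]; last exact: scalerDl.
    by rewrite big_split opprD addrACA; apply: submodD.
  + exists (fun j => r * c j).
    rewrite (eq_bigr (fun j : 'I_n => r *: (c j *: v j))) => [|j _]; last by rewrite scalerA.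
    by rewrite -scaler_sumr -scalerBr; apply: submodZ.
- by move=> n w Zw; exists (fun=> 0); rewrite big1 => [|j _]; rewrite ?scale0r // subr0.
- move=> n w [c hc]; apply: (CB 0%N); apply: (submod_diff (hC 0%N) (ZC _ _ hc)).
  by apply: (submod_sum (F := fun j => c j *: v j)) => // j _; apply: submodZ => //;
     apply: (Cv 0%N).
- move=> n w [c hc]; exists (fun j => if (j < n)%N then c j else 0).
  rewrite big_ord_recr /= ltnn scale0r addr0.
  by rewrite (eq_bigr (fun j : 'I_n => c j *: v j)) // => j _; rewrite ltn_ord.
(* Stability would express [v N] through the earlier vectors, a relation whose last coefficient is
   1. *)
have [|c hc] := NP N.+1 (leqnSn N) (v N).
  exists (fun j => (j == N)%:R); rewrite big_ord_recr /= eqxx scale1r big1 ?add0r ?subrr.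
    exact: submod0.
  by move=> j _; rewrite ltn_eqF ?scale0r.
have := coefm N.+1 0%N (fun j => if (j < N)%N then - c j else 1).
rewrite big_ord_recr /= ltnn scale1r (eq_bigr (fun j : 'I_N => - (c j *: v j))); last first.
  by move=> j _; rewrite ltn_ord scaleNr.
rewrite sumrN addrC => /(_ hc N (leqnn _)); rewrite ltnn; exact: (m_not1 locm).
Qed.

(** The socle is what all generators of [m] kill. Dropping the generators one by one, each time by
    [artin_torsion], ends with the whole module. *)
Lemma artin_of_socle Z : noetherian R -> submod Z ->
  (forall y v, m y -> exists n, Z (y ^+ n *: v)) ->
  noeth_between (fun v => forall y, m y -> Z (y *: v)) Z ->
  artin_between (fun=> True) Z.
Proof.
move=> noethR hZ tors noeS.
have [s [sm ms]] := noeth_fg noethR (ideal_m locm).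
have soc v : (forall y, y \in s -> Z (y *: v)) <-> forall y, m y -> Z (y *: v).
  split=> h y => [my|/sm]; last exact: h.
  apply: (idl_le (K := fun y => Z (y *: v))) (ms y my) => [|_ ->|] //.
    split=> [|a b|r a]; rewrite ?scale0r ?scalerDl -?scalerA; [exact: submod0| exact: submodD|].
    exact: submodZ.
  by rewrite scale0r; apply: submod0.
have : artin_between (fun v => forall y, y \in s -> Z (y *: v)) Z.
  have -> : (fun v => forall y, y \in s -> Z (y *: v)) = fun v => forall y, m y -> Z (y *: v).
    by apply/predeqP.
  by apply: artin_of_noeth_socle => // y v my; apply.
elim: (s) sm => [_|z t IH sm]; first by have -> : (fun=> True) = (fun v : V => forall y,
   y \in [::] -> Z (y *: v)) by apply/predeqP.
move=> art; apply: IH => [y yt|]; first by apply: sm; rewrite inE yt orbT.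
apply: (artin_torsion (y := z)) => //.
- split=> [y _|a b ha hb y yt|r a ha y yt].
  + by rewrite scaler0; apply: submod0.
  + by rewrite scalerDr; apply: submodD => //; [apply: ha | apply: hb].
  + by rewrite scalerA mulrC -scalerA; apply: submodZ => //; apply: ha.
- by move=> v _; apply: tors; apply: sm; rewrite mem_head.
have -> // : (fun v => (forall y, y \in t -> Z (y *: v)) /\ Z (z *: v)) =
   (fun v => forall y, y \in z :: t -> Z (y *: v)).
apply/predeqP => v; split=> [[h1 h2] y|h]; first by rewrite inE => /orP[/eqP->|/h1].
by split=> [y yt|]; apply: h; rewrite inE ?eqxx ?yt ?orbT.
Qed.
End Socle.
End Chains.

(** * The principal ideal theorem and regular sequences *)

Section Regular.
Variable R : comNzRingType.
Implicit Types (I J K P Q : R -> Prop) (s t : seq R).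
Hypothesis noethR : noetherian R.
Variable m : R -> Prop.
Hypothesis locm : local_ring m.

Lemma artin_ideal J (C : nat -> R -> Prop) : ideal_of J -> mprimary m J ->
  (forall n, ideal_of (C n)) -> (forall n, subI J (C n)) -> (forall n, subI (C n.+1) (C n)) ->
  exists N, forall n, (N <= n)%N -> subI (C N) (C n).
Proof.
move=> hJ mJ hC JC Cdec.
apply: (@artin_of_socle R R^o m locm J) => //.
- move=> y v /mJ[k hk]; exists k; exact: (ideal_mulr (v : R) hJ hk).
- by move=> D hD JD _ Dasc; apply: (noethR (I := D)).
Qed.

(* Caruth: with I_n the contraction of (b^n) + Q from the localization at P, the chain
   I_n + (s) stabilizes, and Nakayama gives I_N = I_{N+1}, so b would be a unit at P. *)
Lemma principal_ideal_theorem Q P (s : R) : prime_ideal Q -> prime_ideal P -> subI Q P ->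
  ~ subI P Q -> ~ subI m P -> m s -> ~ mprimary m (addgen Q s).
Proof.
move=> hQ hP QP /existsNP[b /not_implyP[Pb nQb]] nmP ms mQs.
have iQ := prime_ideal_of hQ; have iP := prime_ideal_of hP.
have nPs : ~ P s.
  by move=> Ps; apply: nmP; apply: (mprimary_prime mQs hP); apply: addgen_le.
pose I n r := exists2 u, ~ P u & addgen Q (b ^+ n) (u * r).
have nPM u u' : ~ P u -> ~ P u' -> ~ P (u * u').
  by move=> h1 h2 /(primeM hP)[].
have iA n := ideal_addgen (b ^+ n) iQ.
have hI n : ideal_of (I n).
  split=> [|x y [u nu hu] [u' nu' hu']|r x [u nu hu]].
  - by exists 1; [exact: prime_not1 | rewrite mulr0; apply: ideal0].
  - exists (u * u'); first exact: nPM.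
    have -> : u * u' * (x + y) = u' * (u * x) + u * (u' * y) by ring.
    by apply: idealD => //; apply: ideal_mull.
  - by exists u => //; rewrite mulrCA; apply: ideal_mull.
have Idec n : subI (I n.+1) (I n).
  move=> x [u nu [r hr]]; exists u => //; exists (r * b); by rewrite -mulrA -exprS.
have QI n : subI Q (I n).
  move=> x Qx; exists 1; first exact: prime_not1.
  by rewrite mul1r; apply: addgen_base.
have [|||||N NP] := artin_ideal (J := addgen Q s) (C := fun n => addgen (I n) s).
- exact: ideal_addgen.
- by [].
- by move=> n; apply: ideal_addgen.
- move=> n; apply: addgen_le; [exact: ideal_addgen | | exact: addgen_gen].
  by move=> x /(QI n); apply: addgen_base.
- move=> n; apply: addgen_le; [exact: ideal_addgen | | exact: addgen_gen].
  by move=> x /Idec; apply: addgen_base.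
(* Since [s] lies outside [P], it can be absorbed into the multiplier [u]: from [r * s] in [I N]
   follows [r] in [I N]. *)
have step z : I N z -> exists2 r, I N r & I N.+1 (z - r * s).
  move=> Iz; have [|r hr] := NP N.+1 (leqnSn _) z; first exact: addgen_base.
  exists r => //; have : I N (r * s).
    by rewrite -(subKr z (r * s)); apply: idealB => //; apply: Idec.
  by move=> [u nu hu]; exists (u * s); [exact: nPM | rewrite -mulrA (mulrC s)].
have IN z : I N z -> I N.+1 z.
  move=> Iz; apply: (krull_intersection1 noethR locm (hI _) ms) => k.
  elim: k z Iz => [|k IH] z Iz; first by exists z; rewrite mulr1 subrr; apply: ideal0.
  have [r Ir hz] := step z Iz; have [r' hr'] := IH r Ir.
  exists r'; have -> : z - r' * s ^+ k.+1 = z - r * s + s * (r - r' * s ^+ k).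
    by rewrite exprS; ring.
  by apply: idealD => //; apply: ideal_mull.
have [|u nu [r hr]] := IN (b ^+ N).
  by exists 1; [exact: prime_not1 | rewrite mul1r; apply: addgen_gen].
have : Q (b ^+ N * (u - r * b)).
  have -> // : b ^+ N * (u - r * b) = u * b ^+ N - r * b ^+ N.+1.
  by rewrite exprS; ring.
move=> /(primeM hQ)[/(primeX hQ) //|/QP]; move/(ideal_diff iP) => h.
by apply: nu; apply: h; apply: ideal_mull.
Qed.

(** A prime [Q] over [I + (w)] contains a listed [P]. If [w] is in [P], then so is [m]; otherwise
    [P] is strictly below [Q], and as [P + (b)] is primary to [m], the principal ideal theorem
    leaves only [Q = m]. *)
Lemma mprimary_exchange I b w (Ps : seq (R -> Prop)) : ideal_of I ->
  mprimary m (addgen I b) -> m b ->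
  (forall P, P \in Ps -> prime_ideal P /\ subI I P) ->
  (forall Q, prime_ideal Q -> subI I Q -> exists2 P, P \in Ps & subI P Q) ->
  (forall P, P \in Ps -> P w -> subI m P) -> mprimary m (addgen I w).
Proof.
move=> hI mI mb Ps1 Ps2 Psw; apply: mprimary_of_primes => //; first exact: ideal_addgen.
move=> Q hQ IwQ; have IQ : subI I Q by move=> x Ix; apply/IwQ/addgen_base.
have Qw : Q w by apply/IwQ/addgen_gen.
have [P PPs PQ] := Ps2 Q hQ IQ; have [hP IP] := Ps1 P PPs.
have [Pw|nPw] := EM (P w); first by move=> x mx; apply/PQ/(Psw P).
apply: contrapT => nmQ; apply: (principal_ideal_theorem hP hQ PQ _ nmQ mb).
  by move=> QP; apply/nPw/QP.
move=> x /mI[k [r hr]]; exists k, r; exact: IP.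
Qed.

Definition nzd J y := forall r, J (r * y) -> J r.
Fixpoint reg J s : Prop := if s is y :: s' then nzd J y /\ reg (addgen J y) s' else True.

Lemma nzdX J y k : nzd J y -> nzd J (y ^+ k).
Proof.
move=> hy; elim: k => [|k IH] r; first by rewrite mulr1.
by rewrite exprSr mulrA => /hy; apply: IH.
Qed.

(** Some power of [b] is a multiple of [w] modulo [I], so whatever [w] kills is killed by that
    power. *)
Lemma nzd_exchange I b w : ideal_of I -> nzd I b -> m b -> mprimary m (addgen I w) -> nzd I w.
Proof.
move=> hI nb mb mw r hr; have [k [c hc]] := mw _ mb.
apply: (nzdX (k := k) nb).
have -> : r * b ^+ k = r * (b ^+ k - c * w) + c * (r * w) by ring.
by apply: idealD => //; apply: ideal_mull.
Qed.

Lemma reg_cat J s t : reg J (s ++ t) <-> reg J s /\ reg (idl J s) t.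
Proof. by elim: s J => [|y s IH] J /=; [tauto | rewrite IH; tauto]. Qed.
Lemma reg_rcons J s y : reg J (rcons s y) <-> reg J s /\ nzd (idl J s) y.
Proof. by rewrite -cats1 reg_cat /=; tauto. Qed.

(** An element of [J : y] is [x] times another one modulo [J]; iterating puts it in every
    [J + (x^k)], hence in [J] by Krull. The second half divides the relation by [x] directly. *)
Lemma nzd_swap J x y : ideal_of J -> m x -> nzd J x -> nzd (addgen J x) y ->
  nzd J y /\ nzd (addgen J y) x.
Proof.
move=> hJ mx nx ny; split=> [s hs|s [u hu]].
  apply: (krull_intersection1 noethR locm hJ mx) => k.
  elim: k s hs => [|k IH] s hs; first by exists s; rewrite mulr1 subrr; apply: ideal0.
  have [|r hr] := ny s; first exact: addgen_base.
  have [|r' hr'] := IH r.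
    apply: nx; have -> : r * y * x = s * y - y * (s - r * x) by ring.
    by apply: idealB => //; apply: ideal_mull.
  exists r'; have -> : s - r' * x ^+ k.+1 = s - r * x + x * (r - r' * x ^+ k).
    by rewrite exprS; ring.
  by apply: idealD => //; apply: ideal_mull.
have [|v hv] := ny u.
  by exists s; rewrite -opprB; apply: idealN.
exists v; apply: nx.
have -> : (s - v * y) * x = s * x - u * y + y * (u - v * x) by ring.
by apply: idealD => //; apply: ideal_mull.
Qed.

Lemma reg_move J x u t : ideal_of J -> m x -> (forall y, y \in u -> m y) ->
  reg J (x :: u ++ t) <-> reg J (u ++ x :: t).
Proof.
move=> hJ mx; elim: u J hJ => [|z u IH] J hJ um //; rewrite [in X in _ <-> X]/=.
have mz : m z by apply: um; rewrite mem_head.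
rewrite -IH; [ | exact: ideal_addgen | by move=> y yu; apply: um; rewrite inE yu orbT].
have swap a b : m a -> reg J [:: a, b & u ++ t] -> reg J [:: b, a & u ++ t].
  move=> ma /= [na [nb h]]; have [h1 h2] := nzd_swap hJ ma na nb; split=> //; split=> //.
  have -> // : addgen (addgen J b) a = addgen (addgen J a) b.
  by apply: (@idl_eqi _ J [:: b; a] [:: a; b] hJ) => i; rewrite !inE orbC.
split; exact: swap.
Qed.

Lemma reg_perm J s t : ideal_of J -> (forall y, y \in s -> m y) -> perm_eq s t ->
  reg J s -> reg J t.
Proof.
elim: t s J => // x t IH s J hJ sm pst.
have xs : x \in s by rewrite (perm_mem pst) mem_head.
case/splitPr: xs sm pst => s1 s2 sm pst.
have pst' : perm_eq (s1 ++ s2) t.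
  by rewrite -(perm_cons x) -(permPr pst) -(cat1s x (s1 ++ s2)) perm_catCA.
have sm' y : y \in s1 ++ s2 -> m y.
  by move=> h; apply: sm; move: h; rewrite !mem_cat inE => /orP[] ->; rewrite ?orbT.
rewrite -reg_move //; first by move=> /= [nx /(IH _ _ (ideal_addgen x hJ) sm' pst')].
  by apply: sm; rewrite mem_cat mem_head orbT.
by move=> y ys; apply: sm'; rewrite mem_cat ys.
Qed.

(** Taking a power is harmless at the last place, where nothing is computed modulo the element;
    permutability brings [y] there and back. *)
Lemma reg_head_pow J y s k : ideal_of J -> m y -> (forall z, z \in s -> m z) ->
  reg J (y :: s) -> reg J (y ^+ k.+1 :: s).
Proof.
move=> hJ my sm h.
have mk : m (y ^+ k.+1) by apply: idealX => //; apply: ideal_m.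
have {h} : reg J (rcons s y).
  apply: reg_perm hJ _ _ h; first by move=> z; rewrite inE => /orP[/eqP->|/sm].
  by rewrite perm_sym perm_rcons.
move/reg_rcons => [h1 h2].
apply: (@reg_perm _ (rcons s (y ^+ k.+1))) => //; last by apply/reg_rcons; split=> //; apply: nzdX.
  by move=> z; rewrite mem_rcons inE => /orP[/eqP->|/sm].
by rewrite perm_rcons.
Qed.

Definition pows k s := [seq y ^+ k | y <- s].

Lemma pows_m k s : (forall y, y \in s -> m y) -> forall y, y \in pows k.+1 s -> m y.
Proof. by move=> sm _ /mapP[y /sm ? ->]; apply: idealX => //; apply: ideal_m. Qed.

Lemma reg_pows J u s k : ideal_of J -> (forall y, y \in u ++ s -> m y) ->
  reg J (u ++ s) -> reg J (u ++ pows k.+1 s).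
Proof.
move=> hJ; elim: s u => // y s IH u usm.
have my : m y by apply: usm; rewrite mem_cat mem_head orbT.
have um z : z \in u -> m z by move=> zu; apply: usm; rewrite mem_cat zu.
have sm z : z \in s -> m z by move=> zs; apply: usm; rewrite mem_cat inE zs !orbT.
have mk : m (y ^+ k.+1) by apply: idealX => //; apply: ideal_m.
have us z : z \in u ++ s -> m z by rewrite mem_cat => /orP[/um|/sm].
rewrite -reg_move // => /(reg_head_pow k hJ my us).
rewrite reg_move // -cat_rcons => h; rewrite [pows _ _]/= -cat_rcons.
by apply: IH h => z; rewrite cat_rcons mem_cat inE => /or3P[/um|/eqP->|/sm].
Qed.

End Regular.

(** * Comparing systems of parameters *)

Section Links.
Variable R : comNzRingType.
Implicit Types (I J K P Q : R -> Prop) (s t : seq R) (D e : R).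
Hypothesis noethR : noetherian R.
Variable m : R -> Prop.
Hypothesis locm : local_ring m.

Local Notation gen := (idl (@zero_ideal R)).

Lemma ideal_gen s : ideal_of (gen s).
Proof. by apply: ideal_idl; apply: ideal_zero. Qed.
Lemma gen_mem s y : y \in s -> gen s y.
Proof. by apply: idl_gen; apply: ideal_zero. Qed.
Lemma gen_le s K : ideal_of K -> (forall y, y \in s -> K y) -> subI (gen s) K.
Proof. by move=> hK; apply: idl_le => // _ ->; apply: ideal0. Qed.
Lemma gen_eqi s t : s =i t -> gen s = gen t.
Proof. by apply: idl_eqi; apply: ideal_zero. Qed.

Lemma pows_comp j k s : pows k (pows j s) = pows (j * k) s.
Proof. by rewrite /pows -map_comp; apply: eq_map => y /=; rewrite exprM. Qed.
Lemma mem_pows k s y : y \in s -> y ^+ k \in pows k s.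
Proof. exact: map_f. Qed.
Lemma pows_cat k s t : pows k (s ++ t) = pows k s ++ pows k t.
Proof. exact: map_cat. Qed.
Lemma pows1 s : pows 1 s = s.
Proof. by rewrite /pows (eq_map (g := id)) ?map_id. Qed.

Lemma eqi_mid (T : eqType) (x : T) (a b : seq T) : a ++ x :: b =i x :: a ++ b.
Proof. by move=> i; rewrite !(mem_cat, inE) orbCA. Qed.

Lemma mprimary_gen s I : ideal_of I -> mprimary m (gen s) ->
  (forall y, y \in s -> exists k, I (y ^+ k)) -> mprimary m I.
Proof.
move=> hI ms h; apply: (mprimary_of_primes noethR) => // P hP IP.
apply: (mprimary_prime ms hP); apply: gen_le; first exact: prime_ideal_of.
by move=> y /h[k /IP]; apply: primeX.
Qed.

Lemma reg_mid_pow J u y t k : ideal_of J -> (forall z, z \in u ++ y :: t -> m z) ->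
  reg J (u ++ y :: t) -> reg J (u ++ y ^+ k.+1 :: t).
Proof.
move=> hJ hm.
have my : m y by apply: hm; rewrite mem_cat mem_head orbT.
have um z : z \in u -> m z by move=> zu; apply: hm; rewrite mem_cat zu.
have sm z : z \in u ++ t -> m z.
  by move=> h; apply: hm; rewrite eqi_mid inE h orbT.
have mk : m (y ^+ k.+1) by apply: idealX => //; apply: (ideal_m locm).
rewrite -(reg_move noethR locm t hJ my um) -(reg_move noethR locm t hJ mk um).
exact: (reg_head_pow noethR locm).
Qed.

Lemma nzd_last J x t : ideal_of J -> (forall z, z \in x :: t -> m z) ->
  reg J (x :: t) -> reg J t /\ nzd (idl J t) x.
Proof.
move=> hJ hm h; apply/reg_rcons; apply: (reg_perm noethR locm) h => //.
by rewrite perm_sym perm_rcons.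
Qed.

(** The colon formula (s^(j+1)) : (s) = (s^(j+1)) + (A^j), with A the product of [s]. It is used to
    write a socle class of H over the denominator A itself. *)
Lemma colon_pows J s j r : ideal_of J -> (forall z, z \in s -> m z) -> reg J s ->
  (forall y, y \in s -> idl J (pows j.+1 s) (y * r)) ->
  exists u, idl J (pows j.+1 s) (r - (\prod_(y <- s) y) ^+ j * u).
Proof.
elim: s J r => [|x s IH] J r hJ sm hreg h.
  by exists r; rewrite big_nil expr1n mul1r subrr; apply: ideal0.
have sm' z : z \in s -> m z by move=> zs; apply: sm; rewrite inE zs orbT.
have psm : forall z, z \in x :: pows j.+1 s -> m z.
  move=> z; rewrite inE => /orP[/eqP->|]; first by apply: sm; rewrite mem_head.
  exact: (pows_m locm).
have [_ nx] : reg J (pows j.+1 s) /\ nzd (idl J (pows j.+1 s)) x.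
  by apply: nzd_last => //; apply: (reg_pows noethR locm (u := [:: x])).
rewrite [pows _ _]/= idl_cons //; set K := idl J _ in nx *.
have hK : ideal_of K by apply: ideal_idl.
have {}h y : y \in x :: s -> addgen K (x ^+ j.+1) (y * r).
  by move=> /h; rewrite [pows _ _]/= idl_cons.
have [|v hv] := h x; first by rewrite mem_head.
have {}hv : K (r - v * x ^+ j).
  by apply: nx; have -> : (r - v * x ^+ j) * x = x * r - v * x ^+ j.+1 by rewrite exprS; ring.
have [||||u hu] := IH (addgen J x) v => //.
- exact: ideal_addgen.
- by case: hreg.
- move=> y ys; have [|w hw] := h y; first by rewrite inE ys orbT.
  rewrite -[idl _ _]/(idl J (x :: pows j.+1 s)) idl_cons //.
  exists w; apply: (nzdX (k := j) nx).
  have -> : (y * v - w * x) * x ^+ j = y * r - w * x ^+ j.+1 - y * (r - v * x ^+ j).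
    by rewrite exprS; ring.
  by apply: idealB => //; apply: ideal_mull.
move: hu; rewrite -[idl _ _]/(idl J (x :: pows j.+1 s)) idl_cons // => -[z hz].
exists u, z; rewrite big_cons exprMn.
set b := (\prod_(i <- s) i) ^+ j in hz *.
have -> : r - x ^+ j * b * u - z * x ^+ j.+1 = r - v * x ^+ j + x ^+ j * (v - b * u - z * x).
  by rewrite exprS; ring.
by apply: idealD => //; apply: ideal_mull.
Qed.

(** * Links between parameter systems, uniform in the Frobenius power *)

Section Frobenius.
Variable p : nat.
Hypothesis pP : p \in [pchar R].

Lemma p_gt0 n : (0 < p ^ n)%N.
Proof. by rewrite expn_gt0 prime_gt0 //; case/andP: pP. Qed.

Lemma expD n x y : (x + y) ^+ (p ^ n) = x ^+ (p ^ n) + y ^+ (p ^ n) :> R.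
Proof.
rewrite exprDn_pchar // pnatX pnatE ?pP //; by case/andP: pP.
Qed.
Lemma expB n x y : (x - y) ^+ (p ^ n) = x ^+ (p ^ n) - y ^+ (p ^ n) :> R.
Proof. by apply: (addIr (y ^+ (p ^ n))); rewrite -expD !subrK. Qed.

Lemma frob_gen s n x : gen s x -> gen (pows (p ^ n) s) (x ^+ (p ^ n)).
Proof.
apply: (gen_le (K := fun x => gen (pows (p ^ n) s) (x ^+ (p ^ n)))).
  split=> [|a b ha hb|r a ha].
  - by rewrite expr0n gtn_eqF ?p_gt0 //; apply: ideal0; apply: ideal_gen.
  - by rewrite expD; apply: idealD => //; apply: ideal_gen.
  - by rewrite exprMn; apply: ideal_mull => //; apply: ideal_gen.
by move=> y ys; apply: gen_mem; apply: map_f.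
Qed.

(** Multiplication by [D ^+ q] is a well-defined injection from R/(s^q) to R/(t^q), for all
    [q = p ^ n] with the same [D]. *)
Definition link D s t := forall n r,
  gen (pows (p ^ n) s) r <-> gen (pows (p ^ n) t) (D ^+ (p ^ n) * r).

Lemma link_trans D e s t u : link D s t -> link e t u -> link (e * D) s u.
Proof. by move=> h1 h2 n r; rewrite h1 h2 mulrA exprMn. Qed.

Lemma link_gen_eq s t : gen s = gen t -> link 1 s t.
Proof.
suff sub s' t' n : gen s' = gen t' -> subI (gen (pows (p ^ n) s')) (gen (pows (p ^ n) t')).
  by move=> h n r; rewrite expr1n mul1r; split; apply: sub.
move=> h; apply: gen_le; first exact: ideal_gen.
by move=> _ /mapP[y ys ->]; apply: frob_gen; rewrite -h; apply: gen_mem.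
Qed.

Lemma link_eq_gen s s' t t' D : gen s = gen s' -> gen t = gen t' -> link D s t -> link D s' t'.
Proof.
move=> /esym/link_gen_eq h1 /link_gen_eq h2 h.
by have := link_trans (link_trans h1 h) h2; rewrite mulr1 mul1r.
Qed.

(** Frobenius turns the congruence into w^q = D^q b^q modulo (t^q). Since w^q is a nonzerodivisor
    there, multiplication by D^q from the quotient by b^q to the quotient by w^q is injective. *)
Lemma link_head b w t D : (forall z, z \in w :: t -> m z) -> reg (@zero_ideal R) (w :: t) ->
  gen t (w - D * b) -> link D (b :: t) (w :: t).
Proof.
move=> hm hreg hw n r; set q := (p ^ n)%N; rewrite [pows q (b :: t)]/= [pows q (w :: t)]/= !idl_cons; try exact: ideal_zero.
set J := gen _; have hJ : ideal_of J by apply: ideal_gen.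
have {}hw : J (w ^+ q - D ^+ q * b ^+ q) by rewrite -exprMn -expB; apply: frob_gen.
have nw : nzd J (w ^+ q).
  have q1 : q = q.-1.+1 by rewrite prednK ?p_gt0.
  have [||_ ] := @nzd_last (@zero_ideal R) (w ^+ q) (pows q t) (@ideal_zero R) => //.
    by rewrite -[_ :: _]/(pows q (w :: t)) q1; apply: (pows_m locm).
  rewrite -[_ :: _]/([::] ++ pows q (w :: t)) q1.
  by apply: (reg_pows noethR locm) => //; apply: ideal_zero.
split=> [] [u hu]; exists u.
  have -> : D ^+ q * r - u * w ^+ q = D ^+ q * (r - u * b ^+ q) - u * (w ^+ q - D ^+ q * b ^+ q).
    by ring.
  by apply: idealB => //; apply: ideal_mull.
apply: nw; have -> : (r - u * b ^+ q) * w ^+ q = (r - u * b ^+ q) * (w ^+ q - D ^+ q * b ^+ q)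
   + b ^+ q * (D ^+ q * r - u * w ^+ q + u * (w ^+ q - D ^+ q * b ^+ q)) by ring.
apply: idealD => //; first exact: ideal_mull.
by apply: ideal_mull => //; apply: idealD => //; apply: ideal_mull.
Qed.

Lemma link_mid a b w t D : (forall z, z \in a ++ w :: t -> m z) ->
  reg (@zero_ideal R) (a ++ w :: t) ->
  gen (a ++ t) (w - D * b) -> link D (a ++ b :: t) (a ++ w :: t).
Proof.
move=> hm hreg hw.
apply: (@link_eq_gen (b :: a ++ t) _ (w :: a ++ t)); try by apply: gen_eqi => i; rewrite eqi_mid.
apply: link_head => //; first by move=> z; rewrite -eqi_mid; apply: hm.
apply/(reg_move noethR locm) => //; first exact: ideal_zero.
  by apply: hm; rewrite mem_cat mem_head orbT.
by move=> z za; apply: hm; rewrite mem_cat za.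
Qed.

Lemma link_pows a s j l : (forall z, z \in a ++ s -> m z) -> reg (@zero_ideal R) (a ++ s) ->
  link ((\prod_(y <- s) y) ^+ l) (a ++ pows j.+1 s) (a ++ pows (j.+1 + l) s).
Proof.
elim: s a => [|y s IH] a hm hreg.
  by rewrite big_nil expr1n !cats0; apply: link_gen_eq.
have mw : m (y ^+ (j + l).+1).
  by apply: idealX => //; [exact: (ideal_m locm) | apply: hm; rewrite mem_cat mem_head orbT].
have hm1 k : forall z, z \in (rcons a (y ^+ (j + l).+1)) ++ pows k.+1 s -> m z.
  move=> z; rewrite cat_rcons mem_cat inE => /or3P[za|/eqP->//|].
    by apply: hm; rewrite mem_cat za.
  by apply: (pows_m locm) => i si; apply: hm; rewrite mem_cat inE si !orbT.
have hreg1 : reg (@zero_ideal R) (rcons a (y ^+ (j + l).+1) ++ s).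
  by rewrite cat_rcons; apply: reg_mid_pow => //; apply: ideal_zero.
have hm2 := hm1 0%N; rewrite pows1 in hm2.
have := IH _ hm2 hreg1; rewrite big_cons exprMn mulrC !cat_rcons /= addSn; apply: link_trans.
apply: link_mid.
- by have := hm1 j; rewrite cat_rcons.
- rewrite -cat_rcons; apply: (reg_pows noethR locm) => //; exact: ideal_zero.
- by rewrite -exprD addnS (addnC l) subrr; apply: ideal0; apply: ideal_gen.
Qed.

(* Generic w_i = s_i + (combination of the later s_j) exchanges the a_i for the s_i one at
   a time; on the way back, w_i is replaced by a power of a_i. *)
Lemma link_sop a x s : size x = size s -> (forall z, z \in a ++ x -> m z) ->
  (forall z, z \in s -> m z) -> reg (@zero_ideal R) (a ++ x) ->
  mprimary m (gen (a ++ x)) -> mprimary m (gen (a ++ s)) ->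
  reg (@zero_ideal R) (a ++ s) /\
  exists (K : nat) D, link D (a ++ s) (a ++ pows K.+1 x).
Proof.
elim: x a s => [|b x IH] a [|c s] // => [_ _ _ hreg _ _|[szs] hm sm hreg hx hs].
  by split; last by exists 0%N, 1; apply: link_gen_eq.
have [Ps [Ps1 Ps2]] := minimal_primes noethR (ideal_gen (a ++ x)).
(* A prime of [Ps] that contains [w] contains [c] and [s], hence the whole m-primary ideal of
   [a ++ c :: s], and so it contains [m]. *)
have [y ys yP] := coset_avoidance c (fun P PPs => (Ps1 P PPs).1) (ideal_gen s).
set w := c + y in yP.
have mb : m b by apply: hm; rewrite mem_cat mem_head orbT.
have sm' z : z \in s -> m z by move=> zs; apply: sm; rewrite inE zs orbT.
have mw : m w.
  apply: (idealD (ideal_m locm)); first by apply: sm; rewrite mem_head.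
  exact: (gen_le (ideal_m locm) sm').
have am z : z \in a -> m z by move=> za; apply: hm; rewrite mem_cat za.
have xm z : z \in x -> m z by move=> zx; apply: hm; rewrite mem_cat inE zx !orbT.
have hmw z : z \in a ++ w :: x -> m z by rewrite mem_cat inE => /or3P[/am|/eqP->|/xm].
have gens : gen (a ++ c :: s) = gen (a ++ w :: s).
  have gy t : t = a ++ c :: s \/ t = a ++ w :: s -> gen t y.
    move=> ht; apply: (gen_le (ideal_gen _) _ ys) => z zs; apply: gen_mem.
    by case: ht => ->; rewrite mem_cat inE zs !orbT.
  apply: subI_anti; apply: gen_le; try exact: ideal_gen.
  - move=> z; rewrite eqi_mid inE => /orP[/eqP->|h]; last first.
      by apply: gen_mem; rewrite eqi_mid inE h orbT.
    rewrite -(addrK y c); apply: (idealB (ideal_gen _)); last by apply: gy; right.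
    by apply: gen_mem; rewrite mem_cat mem_head orbT.
  - move=> z; rewrite eqi_mid inE => /orP[/eqP->|h]; last first.
      by apply: gen_mem; rewrite eqi_mid inE h orbT.
    apply: (idealD (ideal_gen _)); last by apply: gy; left.
    by apply: gen_mem; rewrite mem_cat mem_head orbT.
have gmid z t : gen (a ++ z :: t) = addgen (gen (a ++ t)) z.
  by rewrite -idl_cons; [apply: gen_eqi => i; rewrite eqi_mid | exact: ideal_zero].
have hx' : mprimary m (addgen (gen (a ++ x)) w).
  apply: (mprimary_exchange noethR locm (b := b) (Ps := Ps)) => //; first exact: ideal_gen.
    by rewrite -gmid.
  move=> P PPs /(yP P PPs)[Pc sP]; have [hP axP] := Ps1 P PPs.
  apply: (mprimary_prime hs hP); apply: gen_le; first exact: prime_ideal_of.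
  move=> z; rewrite eqi_mid inE => /orP[/eqP->//|]; rewrite mem_cat => /orP[za|zs].
    by apply: axP; apply: gen_mem; rewrite mem_cat za.
  by apply: sP; apply: gen_mem.
have hbx : reg (@zero_ideal R) (a ++ x) /\ nzd (gen (a ++ x)) b.
  apply: nzd_last => //; first exact: ideal_zero.
    by move=> z; rewrite -eqi_mid; apply: hm.
  by apply/(reg_move noethR locm) => //; apply: ideal_zero.
have hregw : reg (@zero_ideal R) (a ++ w :: x).
  apply/(reg_move noethR locm) => //; first exact: ideal_zero.
  apply: (reg_perm noethR locm (s := rcons (a ++ x) w)) => //; first exact: ideal_zero.
  - by move=> z; rewrite mem_rcons -eqi_mid; apply: hmw.
  - by rewrite perm_rcons.
  by apply/reg_rcons; split; [exact: hbx.1 | apply: nzd_exchange hbx.2 mb hx'; apply: ideal_gen].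
have [|||||regs [K [D linkD]]] := IH (rcons a w) s szs.
- by rewrite cat_rcons.
- exact: sm'.
- by rewrite cat_rcons.
- by rewrite cat_rcons gmid.
- by rewrite cat_rcons -gens.
have {}regs : reg (@zero_ideal R) (a ++ c :: s).
  have asm z : z \in a ++ s -> m z by rewrite mem_cat => /orP[/am|/sm'].
  have mc : m c by apply: sm; rewrite mem_head.
  apply/(reg_move noethR locm) => //; first exact: ideal_zero.
  apply: (reg_perm noethR locm (s := rcons (a ++ s) c)).
  - exact: ideal_zero.
  - by move=> z; rewrite mem_rcons inE => /orP[/eqP->|/asm].
  - by rewrite perm_rcons.
  have [h1 h2] : reg (@zero_ideal R) (a ++ s) /\ nzd (gen (a ++ s)) w.
    apply: nzd_last; first exact: ideal_zero.
      by move=> z; rewrite inE => /orP[/eqP->|/asm].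
    apply/(reg_move noethR locm) => //; first exact: ideal_zero.
    by rewrite -cat_rcons.
  apply/reg_rcons; split=> //; apply: nzd_exchange h2 mw _; first exact: ideal_gen.
  by rewrite -gmid.
split=> //.
have pxm k z : z \in pows k.+1 x -> m z by apply: (pows_m locm).
have hx2 : mprimary m (gen (a ++ w :: pows K.+1 x)).
  rewrite -gmid in hx'; apply: (mprimary_gen (ideal_gen _) hx') => z.
  rewrite mem_cat inE => /or3P[za|/eqP->|zx].
  - by exists 1%N; rewrite expr1; apply: gen_mem; rewrite mem_cat za.
  - by exists 1%N; rewrite expr1; apply: gen_mem; rewrite mem_cat mem_head orbT.
  - by exists K.+1; apply: gen_mem; rewrite mem_cat inE mem_pows ?orbT.
(* A power of [b] is a multiple [e * w] modulo [a] and the powers of [x]; this [e] is the multiplier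
   that exchanges [w] for the power of [b]. *)
have [k0 hk0] := hx2 b mb.
have hk : gen (a ++ w :: pows K.+1 x) (b ^+ k0.+1) by apply: ideal_leqX hk0; [exact: ideal_gen|].
move: hk; rewrite gmid => -[e he].
have mbk k : m (b ^+ k.+1) by apply: idealX => //; apply: (ideal_m locm).
have regb k l : reg (@zero_ideal R) (a ++ b ^+ k.+1 :: pows l.+1 x).
  rewrite -cat_rcons; apply: (reg_pows noethR locm); first exact: ideal_zero.
    by move=> z; rewrite cat_rcons mem_cat inE => /or3P[/am|/eqP->|/xm].
  by rewrite cat_rcons; apply: reg_mid_pow => //; apply: ideal_zero.
have hmb k l z : z \in a ++ b ^+ k.+1 :: pows l.+1 x -> m z.
  by rewrite mem_cat inE => /or3P[/am|/eqP->|/pxm].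
have l1 : link e (a ++ w :: pows K.+1 x) (a ++ b ^+ k0.+1 :: pows K.+1 x).
  by apply: link_mid he; [exact: hmb | exact: regb].
(* The exponents [k0.+1] of [b] and [K.+1] of [x] differ; [l2] and [l3] raise both to their sum. *)
have l2 : link ((\prod_(y <- x) y) ^+ k0.+1) (a ++ b ^+ k0.+1 :: pows K.+1 x)
    (a ++ b ^+ k0.+1 :: pows (K.+1 + k0.+1) x).
  rewrite -!(cat_rcons (b ^+ k0.+1)); apply: link_pows; rewrite cat_rcons.
    by have := hmb k0 0%N; rewrite pows1.
  by have := regb k0 0%N; rewrite pows1.
have l3 : link (b ^+ K.+1) (a ++ b ^+ k0.+1 :: pows (K.+1 + k0.+1) x)
    (a ++ b ^+ (K.+1 + k0.+1) :: pows (K.+1 + k0.+1) x).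
  apply: link_mid; [exact: hmb | exact: regb |].
  by rewrite exprD subrr; apply: ideal0; apply: ideal_gen.
exists (K + k0.+1)%N; eexists.
have l0 : link D (a ++ c :: s) (a ++ w :: pows K.+1 x).
  by apply: link_eq_gen linkD; rewrite cat_rcons // gens.
exact: link_trans (link_trans (link_trans l0 l1) l2) l3.
Qed.

End Frobenius.
End Links.

(** * Top local cohomology as a quotient of R[X] *)

Section CechPoly.
Variable R : comNzRingType.
Variable s : seq R.
Implicit Types (f g : {poly R}) (r : R).
Local Notation gen := (idl (@zero_ideal R)).
Local Notation A := (\prod_(y <- s) y).

(* The class of sum_j r_j / A^j in H is represented by the polynomial sum_j r_j 'X^j. *)
Definition cech_eval K f : R := \sum_(j < K) f`_j * A ^+ (K - j).
(** Over the denominator A^(K+1) the numerator lies in (s^(K+1)). The size bound ensures that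
    [cech_eval] drops no term. *)
Definition cech_zero f := exists K,
  (size f <= K.+1)%N /\ gen (pows K.+1 s) (cech_eval K.+1 f).

Lemma cech_evalD K f g : cech_eval K (f + g) = cech_eval K f + cech_eval K g.
Proof. by rewrite -big_split; apply: eq_bigr => j _; rewrite coefD mulrDl. Qed.
Lemma cech_evalZ K r f : cech_eval K (r *: f) = r * cech_eval K f.
Proof. by rewrite mulr_sumr; apply: eq_bigr => j _; rewrite coefZ mulrA. Qed.
Lemma cech_eval_raise K l f : (size f <= K)%N -> cech_eval (K + l) f = A ^+ l * cech_eval K f.
Proof.
move=> sf; rewrite /cech_eval big_split_ord /= [X in _ + X]big1 ?addr0 => [|j _]; last first.
  by rewrite nth_default ?mul0r // (leq_trans sf) // leq_addr.
rewrite mulr_sumr; apply: eq_bigr => j _.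
by rewrite mulrCA -exprD addnC addnBA // ltnW.
Qed.
Lemma cech_eval_mono K r j : (j < K)%N -> cech_eval K (r *: 'X^j) = r * A ^+ (K - j).
Proof.
move=> jK; rewrite /cech_eval (bigD1 (Ordinal jK)) //= coefZ coefXn eqxx mulr1.
rewrite [X in _ + X]big1 ?addr0 // => i /negbTE ni; rewrite coefZ coefXn.
by rewrite -[_ == _ :> nat]/(i == Ordinal jK) ni mulr0 mul0r.
Qed.

Lemma gen_prod k l r : gen (pows k s) r -> gen (pows (k + l) s) (A ^+ l * r).
Proof.
have hI := @ideal_gen R (pows (k + l) s).
apply: (gen_le (K := fun r => gen (pows (k + l) s) (A ^+ l * r))).
  split=> [|a b ha hb|c a ha]; first by rewrite mulr0; apply: ideal0.
    by rewrite mulrDr; apply: idealD.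
  by rewrite mulrCA; apply: ideal_mull.
move=> _ /mapP[y ys ->]; rewrite (big_rem y) //= exprMn mulrAC -exprD (addnC l).
by apply: ideal_mulr => //; apply: gen_mem; apply: mem_pows.
Qed.

Lemma cech_zero_large f : cech_zero f -> exists K0, forall K, (K0 <= K)%N ->
  (size f <= K.+1)%N /\ gen (pows K.+1 s) (cech_eval K.+1 f).
Proof.
move=> [K [sf hK]]; exists K => L KL; split; first exact: leq_trans sf _.
by rewrite -(subnKC KL) -addSn cech_eval_raise //; apply: gen_prod.
Qed.

Lemma submod_cech_zero : submod cech_zero.
Proof.
split=> [|f g|r f].
- exists 0%N; rewrite size_poly0; split=> //.
  have -> : cech_eval 1 0 = 0 by rewrite -(scale0r 0) cech_evalZ mul0r.
  by apply: ideal0; apply: ideal_gen.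
- move=> /cech_zero_large[K0 h0] /cech_zero_large[K1 h1]; exists (maxn K0 K1).
  have [sf hf] := h0 _ (leq_maxl K0 K1); have [sg hg] := h1 _ (leq_maxr K0 K1).
  split; first by rewrite (leq_trans (size_polyD _ _)) // geq_max sf.
  by rewrite cech_evalD; apply: idealD => //; apply: ideal_gen.
- move=> [K [sf hf]]; exists K; split; first exact: leq_trans (size_scale_leq _ _) _.
  by rewrite cech_evalZ; apply: ideal_mull => //; apply: ideal_gen.
Qed.

(** All terms are brought over one denominator. Its exponent is kept positive, so that the
    corresponding powers of [s] stay in the maximal ideal. *)
Lemma cech_reduce f j : (size f <= j.+1)%N -> cech_zero (f - cech_eval j.+1 f *: 'X^(j.+1)).
Proof.
move=> sf; exists j.+1; split.
  rewrite (leq_trans (size_polyD _ _)) // geq_max (leq_trans sf) //= size_polyN.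
  by rewrite (leq_trans (size_scale_leq _ _)) // size_polyXn.
rewrite cech_evalD -scaleNr cech_eval_mono // mulNr subSnn.
rewrite -[j.+2 in X in cech_eval X f]addn1 cech_eval_raise // expr1 mulrC subrr.
by apply: ideal0; apply: ideal_gen.
Qed.

Lemma cech_reduceE f : exists r j, cech_zero (f - r *: 'X^(j.+1)).
Proof.
by exists (cech_eval (size f).+1 f), (size f); apply: cech_reduce; apply: leqnSn.
Qed.

Lemma cech_shift r j l : cech_zero (r *: 'X^j - (r * A ^+ l) *: 'X^(j + l)).
Proof.
exists (j + l)%N; split.
  rewrite (leq_trans (size_polyD _ _)) // geq_max size_polyN.
  by rewrite !(leq_trans (size_scale_leq _ _)) // size_polyXn // ltnS leq_addr.
rewrite cech_evalD -scaleNr !cech_eval_mono ?ltnS ?leq_addr // mulNr -mulrA -exprD.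
have -> : (l + ((j + l).+1 - (j + l)) = (j + l).+1 - j)%N.
  by rewrite subSnn -addnS addKn addn1.
by rewrite subrr; apply: ideal0; apply: ideal_gen.
Qed.

Section Frobenius.
Variable p : nat.
Hypothesis pP : p \in [pchar R].

Lemma poly_pchar : p \in [pchar {poly R}]. Proof. by rewrite pchar_poly. Qed.

Lemma exp_sum (S : comNzRingType) n k (F : 'I_k -> S) : p \in [pchar S] ->
  (\sum_i F i) ^+ (p ^ n) = \sum_i F i ^+ (p ^ n).
Proof.
move=> pS; apply: (big_morph (fun x => x ^+ (p ^ n))) => [x y|]; first exact: expD.
by rewrite expr0n gtn_eqF // (p_gt0 pS).
Qed.

Lemma cech_eval_frob n K f : (size f <= K)%N ->
  cech_eval (K * p ^ n) (f ^+ (p ^ n)) = cech_eval K f ^+ (p ^ n).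
Proof.
move=> sf; have q0 := p_gt0 pP n; set q := (p ^ n)%N in q0 *.
have {1}-> : f = \sum_(i < K) f`_i *: 'X^i.
  rewrite -poly_def; apply/polyP => i; rewrite coef_poly.
  by case: ltnP => // Ki; rewrite nth_default // (leq_trans sf).
rewrite exp_sum ?poly_pchar // exp_sum //.
rewrite (big_morph (cech_eval (K * q)) (@cech_evalD _) (id1 := 0)); last first.
  by rewrite -(scale0r 0) cech_evalZ mul0r.
apply: eq_bigr => i _; rewrite exprZn -exprM cech_eval_mono ?ltn_pmul2r //.
by rewrite exprMn -exprM mulnBl.
Qed.

Lemma cech_zero_frob n f : cech_zero f -> cech_zero (f ^+ (p ^ n)).
Proof.
move=> [K [sf hf]]; have q0 := p_gt0 pP n.
have e : ((K.+1 * p ^ n).-1.+1 = K.+1 * p ^ n)%N by rewrite prednK // muln_gt0.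
exists (K.+1 * p ^ n).-1; rewrite e; split.
  case sf0: (size f) => [|k].
    move/eqP: sf0; rewrite size_poly_eq0 => /eqP->.
    by rewrite expr0n gtn_eqF // size_poly0.
  rewrite -e (leq_trans (size_poly_exp_leq _ _)) // ltnS sf0 /=.
  by rewrite -ltnS e (leq_ltn_trans (n := (K * p ^ n)%N)) ?ltn_pmul2r // leq_mul2r -ltnS -sf0 sf orbT.
by rewrite cech_eval_frob // -pows_comp; apply: frob_gen.
Qed.

(** * Injectivity of the direct system and the Artinian property *)

Section Local.
Hypothesis noethR : noetherian R.
Variable m : R -> Prop.
Hypothesis locm : local_ring m.
Hypothesis sm : forall z, z \in s -> m z.
Hypothesis sreg : reg (@zero_ideal R) s.
Hypothesis smp : mprimary m (gen s).

(** Regularity of [s] enters here: by [link_pows] at Frobenius exponent 0, multiplication by A^l is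
    injective from R/(s^(j+1)) to R/(s^(j+1+l)), so nothing more dies in the limit. *)
Lemma cech_zero_mono r j : cech_zero (r *: 'X^(j.+1)) <-> gen (pows j.+1 s) r.
Proof.
split=> [/cech_zero_large[K0 h]|h].
  have [sX] := h (maxn K0 j.+1) (leq_maxl _ _).
  have jK := leq_maxr K0 j.+1; rewrite cech_eval_mono ?ltnS //.
  have := @link_pows _ noethR _ locm _ pP [::] s j ((maxn K0 j.+1).+1 - j.+1)%N sm sreg 0%N r.
  rewrite expn0 expr1 !pows1 subnKC; last exact: leqW.
  by rewrite [r * _]mulrC => h' /h'.
exists j.+1; split; first by rewrite (leq_trans (size_scale_leq _ _)) // size_polyXn.
by rewrite cech_eval_mono // subSnn mulrC -[j.+2]addn1; apply: gen_prod.
Qed.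

Lemma mprimary_pows k : mprimary m (gen (pows k s)).
Proof.
apply: (mprimary_gen noethR (@ideal_gen _ _) smp) => y ys; exists k.
by apply: gen_mem; apply: mem_pows.
Qed.

Lemma cech_artin : artin_between (fun=> True) cech_zero.
Proof.
have hZ := submod_cech_zero.
apply: (artin_of_socle locm noethR hZ) => [y f my|C hC ZC Csoc Casc].
  have [r [j hf]] := cech_reduceE f; have [k hk] := mprimary_pows j.+1 my.
  exists k; apply: (submod_diff hZ (v := y ^+ k *: (r *: 'X^(j.+1)))).
    by rewrite -scalerBr; apply: submodZ.
  by rewrite scalerA; apply/cech_zero_mono; apply: ideal_mulr => //; apply: ideal_gen.
(* By [colon_pows] a socle class r/A^(j+1) equals u/A. Hence an ascending chain in the socle is read
   off from a chain of ideals of R. *)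
have socX n f : C n f -> exists2 r, cech_zero (f - r *: 'X) & C n (r *: 'X).
  move=> /[dup] Cf /Csoc sf; have [r [j hf]] := cech_reduceE f.
  have [y ys|u hu] := colon_pows noethR locm (s := s) (j := j) (r := r) (@ideal_zero R) sm sreg.
    apply/cech_zero_mono; rewrite -scalerA.
    apply: (submod_diffr hZ (u := y *: f)); last by apply: sf; apply: sm.
    by rewrite -scalerBr; apply: submodZ.
  have hfX : cech_zero (f - u *: 'X).
    apply: (submod_diff hZ (v := f - r *: 'X^(j.+1))) => //.
    have -> : f - u *: 'X - (f - r *: 'X^(j.+1)) = (r - A ^+ j * u) *: 'X^(j.+1) 
      - (u *: 'X^1 - (u * A ^+ j) *: 'X^(1 + j)).
      by rewrite add1n expr1 scalerBl (mulrC u); ring.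
    apply: submodB => //; last exact: cech_shift.
    exact/cech_zero_mono.
  exists u => //; apply: (submod_diffr (hC n) (u := f)) => //; exact: ZC.
have [||N NP] := noethR (I := fun n r => C n (r *: 'X)).
- move=> n; split=> [|a b ha hb|r a ha].
  + by rewrite scale0r; apply: submod0.
  + by rewrite scalerDl; apply: submodD.
  + by rewrite -scalerA; apply: submodZ.
- by move=> n r; apply: Casc.
exists N => n Nn f /socX[r hf hr]; apply: (submod_diff (hC N) (ZC N _ hf)).
exact: NP hr.
Qed.

End Local.
End Frobenius.
End CechPoly.

(** * Graded annihilators over the Frobenius skew polynomial ring *)

Section FrobeniusModule.
Variables (R : comNzRingType) (V : lmodType R) (p : nat) (phi : V -> V).
Implicit Types (G : V -> Prop) (P Q : R -> Prop) (r : R) (u v t : V).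
Hypothesis p_gt1 : (1 < p)%N.
Hypothesis phiD : forall u v, phi (u + v) = phi u + phi v.
Hypothesis phiZ : forall r v, phi (r *: v) = r ^+ p *: phi v.
Hypothesis noethR : noetherian R.
Variables (Z T : V -> Prop) (W : R -> Prop).
Hypothesis artinZ : artin_between (fun=> True) Z.
Hypothesis T_sub : submod T.
Hypothesis T_phi : forall v, T v -> T (phi v).
Hypothesis W1 : W 1.
Hypothesis WM : forall a b, W a -> W b -> W (a * b).

Lemma iter_phiD n u v : iter n phi (u + v) = iter n phi u + iter n phi v.
Proof. by elim: n => //= n ->; rewrite phiD. Qed.
Lemma iter_phiZ n r v : iter n phi (r *: v) = r ^+ (p ^ n) *: iter n phi v.
Proof. by elim: n => [|n IH] /=; rewrite ?expr1 // IH phiZ -exprM expnSr. Qed.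

(* Submodules G such that V/G is an x-torsion-free R[x,f]-module and a quotient of V/Z. *)
Definition torsion_free_quot G := [/\ submod G, forall v, G v -> G (phi v),
  forall v, G (phi v) -> G v & forall v, Z v -> G v].

(** The degree-zero component of the graded annihilator of the R[x,f]-submodule generated by [v] in
    [V / G]. *)
Definition grann G v r := forall n, G (r *: iter n phi v).

Definition max_grann G P := exists v, [/\ T v, ~ G v, P = grann G v &
  forall w, T w -> ~ G w -> subI (grann G v) (grann G w) -> subI (grann G w) (grann G v)].

Section Fixed.
Variable G : V -> Prop.
Hypothesis hG : torsion_free_quot G.

Let subG : submod G. Proof. by case: hG. Qed.
Let Gphi v : G v -> G (phi v). Proof. by case: hG => _ h _ _; apply: h. Qed.
Let phiG v : G (phi v) -> G v. Proof. by case: hG => _ _ h _; apply: h. Qed.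
Let ZG v : Z v -> G v. Proof. by case: hG => _ _ _; apply. Qed.
Let Giter n v : G v -> G (iter n phi v).
Proof. by move=> Gv; elim: n => //= n; apply: Gphi. Qed.

Lemma ideal_grann v : ideal_of (grann G v).
Proof.
split=> [n|a b ha hb n|r a ha n].
- by rewrite scale0r; apply: submod0.
- by rewrite scalerDl; apply: submodD.
- by rewrite -scalerA; apply: submodZ.
Qed.

Lemma grann_iter v n : subI (grann G v) (grann G (iter n phi v)).
Proof. by move=> r hr k; rewrite -iterD. Qed.

Lemma grann_scale v r : subI (grann G v) (grann G (r *: v)).
Proof.
by move=> a ha k; rewrite iter_phiZ scalerA mulrC -scalerA; apply: submodZ.
Qed.

Lemma T_iter n v : T v -> T (iter n phi v).
Proof. by move=> Tv; elim: n => //= n; apply: T_phi. Qed.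

(** If [a] does not kill [iter n phi v], their product has the same annihilator as [v] by
    maximality; and [b] kills it, as [b * a ^+ (p ^ k)] is a multiple of [a * b]. *)
Lemma max_grann_prime P : max_grann G P -> prime_ideal P.
Proof.
move=> [v [Tv nGv -> vmax]]; split; first exact: ideal_grann.
  by move=> /(_ 0%N); rewrite scale1r /=.
move=> a b hab; have [|/existsNP[n nGa]] := EM (grann G v a); first by left.
right; apply: (vmax (a *: iter n phi v)) => //.
- by apply: submodZ => //; apply: T_iter.
- by move=> r hr; apply: grann_scale; apply: grann_iter.
move=> k; rewrite iter_phiZ -iterD scalerA.
have -> : b * a ^+ (p ^ k) = a ^+ (p ^ k).-1 * (a * b).
  have : (0 < p ^ k)%N by rewrite expn_gt0 (ltnW p_gt1).
  by case: (p ^ k)%N => // q _; rewrite exprS /=; ring.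
by rewrite -scalerA; apply: submodZ.
Qed.

Lemma sub_max_grann v : T v -> ~ G v -> exists2 P, max_grann G P & subI (grann G v) P.
Proof.
move=> Tv nGv.
have [||P [[w [Tw nGw -> vw]] Pmax]] := noeth_max noethR (F := fun I => exists w,
  [/\ T w, ~ G w, I = grann G w & subI (grann G v) (grann G w)]).
- by move=> I [w [_ _ -> _]]; apply: ideal_grann.
- by exists (grann G v), v; split=> // r.
exists (grann G w) => //; exists w; split=> // w' Tw' nGw' ww'; apply: Pmax => //.
by exists w'; split=> // r /vw/ww'.
Qed.

(* For a finite set S of maximal annihilators, the elements whose annihilator lies in no
   member of S form a submodule, which strictly shrinks when S grows. *)
Lemma max_grann_finite : exists Ps : seq (R -> Prop), forall P, P \in Ps <-> max_grann G P.
Proof.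
apply: contrapT => nfin.
pose X (S : seq (R -> Prop)) v := forall P, P \in S -> exists2 r, ~ P r & grann G v r.
have maxle P Q : max_grann G P -> max_grann G Q -> subI P Q -> P = Q.
  move=> [v [Tv nGv -> vmax]] [w [Tw nGw -> wmax]] h; apply: subI_anti => //; exact: vmax.
have step (S : seq (R -> Prop)) : (forall P, P \in S -> max_grann G P) ->
    exists P, max_grann G P /\ P \notin S.
  move=> hS; apply: contrapT => h; apply: nfin; exists S => P; split; first exact: hS.
  by move=> hP; apply: contrapT => /negP nP; apply: h; exists P.
have [||u uP] := @dependent_choice _ (fun S : seq (R -> Prop) => forall P, P \in S -> max_grann G P)
   (fun S S' => exists P, [/\ max_grann G P, P \notin S & S' = P :: S]).
- by exists [::].
- move=> S hS; have [P [hP nP]] := step S hS; exists (P :: S); split; last by exists P.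
  by move=> Q; rewrite inE => /orP[/eqP->|/hS].
have [||||N NP] := artinZ (C := fun n => X (u n)).
- move=> n; split=> [P Pu|a b ha hb P Pu|r a ha P Pu].
  + exists 1; first by apply: prime_not1; apply: max_grann_prime; apply: (uP n).1.
    by move=> k; rewrite scale1r; apply: Giter; apply: submod0.
  + have [r nr hr] := ha P Pu; have [r' nr' hr'] := hb P Pu; exists (r * r').
      by move=> /(primeM (max_grann_prime ((uP n).1 P Pu)))[].
    move=> k; rewrite iter_phiD scalerDr; apply: submodD => //.
      by rewrite mulrC -scalerA; apply: submodZ.
    by rewrite -scalerA; apply: submodZ.
  + by have [c nc hc] := ha P Pu; exists c => //; apply: grann_scale.
- move=> n v Zv P Pu; exists 1; first by apply: prime_not1; apply: max_grann_prime; apply: (uP n).1.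
  by move=> k; rewrite scale1r; apply: Giter; apply: ZG.
- by [].
- move=> n v Xv P Pu; apply: Xv; have [_ [Q [_ _ ->]]] := uP n.
  by rewrite inE Pu orbT.
have [uN [P [hP nP uS]]] := uP N.
(* The [v] realizing the new prime lies in [X (u N)], since distinct maximal annihilators are
   incomparable, but not in [X (u N.+1)]. *)
have [v [Tv nGv Pv vmax]] := hP.
have [||r nPr] := NP N.+1 (leqnSn N) v _ P; last by rewrite -Pv.
  move=> Q Qu; apply: contrapT => nQ; move/negP: nP; apply.
  have -> // : P = Q; apply: maxle => //; first exact: uN.
  by move=> r Pr; apply: contrapT => nQr; apply: nQ; exists r; rewrite // -Pv.
by rewrite uS mem_head.
Qed.

End Fixed.

Lemma torsion_free_quot_ann G (b : R -> Prop) : torsion_free_quot G ->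
  torsion_free_quot (fun v => forall r, b r -> grann G v r).
Proof.
move=> hG; have [subG Gphi phiG ZG] := hG.
split.
- split=> [r _ n|u v hu hv r br n|c v hv r br]; last by apply: grann_scale => //; apply: hv.
    have -> : iter n phi 0 = 0 by rewrite -(scale0r 0) iter_phiZ expr0n gtn_eqF ?scale0r ?expn_gt0 ?(ltnW p_gt1).
    by rewrite scaler0; apply: submod0.
  by rewrite iter_phiD scalerDr; apply: submodD => //; [apply: hu | apply: hv].
- by move=> v hv r br n; rewrite -iterSr; apply: hv.
(* Only exponent 0 is missing: [r ^+ p *: phi v] in [G] is [phi (r *: v)], and [phi] is injective
   modulo [G]. *)
- move=> v hv r br [|n]; last by rewrite iterSr; apply: hv.
  apply: phiG; rewrite phiZ; have := hv r br 0%N => /=.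
  by rewrite -(subnK (ltnW p_gt1)) addn1 exprSr -scalerA => h; apply: submodZ.
- move=> v Zv r br n; apply: submodZ => //; elim: n => [|n IH] /=; [exact: ZG | exact: Gphi].
Qed.

(** Here [n] bounds the chains below maximal annihilators. At [n = 0] there are none, so [T] lies in
    [G]; passing to [G'] lowers the bound by one, because each new maximal annihilator is strictly
    inside an old one. *)
Lemma uniform_annihilator_step n G : torsion_free_quot G ->
  (forall t, T t -> exists2 c, W c & grann G t c) ->
  (forall P, max_grann G P -> ~ exists C, prime_chain n C /\ C n = P) ->
  exists2 c, W c & forall t, T t -> G (c *: t).
Proof.
elim: n G => [|n IH] G hG hT nchain.
  exists 1 => // t Tt; rewrite scale1r; apply: contrapT => nGt.
  have [P hP _] := sub_max_grann hG Tt nGt; apply: (nchain P hP); exists (fun=> P).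
  by split=> //; split=> // i _; apply: max_grann_prime hP.
have [subG Gphi phiG ZG] := hG.
have [Ps PsP] := max_grann_finite hG.
pose b r := forall P, P \in Ps -> P r.
have hG' := torsion_free_quot_ann b hG; set G' := fun v => _ in hG'.
have GG' v : G v -> G' v.
  by move=> Gv r br k; apply: submodZ => //; elim: k => //= k; apply: Gphi.
(* Each prime in [Ps] is the annihilator of an element of [T], so it meets [W]; the product of the
   chosen elements lies in all of them. *)
have [c0 Wc0 bc0] : exists2 c, W c & b c.
  have : forall P, P \in Ps -> exists2 c, W c & P c.
    by move=> P /PsP[v [Tv _ -> _]]; apply: hT.
  have : forall P, P \in Ps -> ideal_of P.
    by move=> P /PsP/(max_grann_prime hG)/prime_ideal_of.
  rewrite /b; elim: (Ps) => [_ _|P Qs IHQ hid hQ]; first by exists 1.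
  have [||c Wc hc] := IHQ.
  - by move=> Q h; apply: hid; rewrite inE h orbT.
  - by move=> Q h; apply: hQ; rewrite inE h orbT.
  have [c' Wc' hc'] := hQ P (mem_head _ _); exists (c * c'); first exact: WM.
  move=> Q; rewrite inE => /orP[/eqP->|h].
    by apply: ideal_mull => //; apply: hid; rewrite mem_head.
  by apply: ideal_mulr; [apply: hid; rewrite inE h orbT | exact: hc].
have [||c Wc hc] := IH G' hG'.
- by move=> t Tt; have [c Wc hc] := hT t Tt; exists c => // k; apply: GG'.
- move=> P hP [C [hC CnP]]; have [v [Tv nGv Pv vmax]] := hP.
  have [r /not_implyP[br /existsNP[k nG]]] : exists r, ~ (b r -> grann G v r).
    exact/existsNP.
  have PG' a : P a -> grann G' v a by rewrite Pv.
  have [|Q hQ vQ] := @sub_max_grann G hG (r *: iter k phi v) _ nG.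
    by apply: submodZ => //; apply: T_iter.
  have PQ : subI P Q.
    move=> a /PG' Pa; apply: vQ => j; rewrite iter_phiZ -iterD scalerA.
    have -> : a * r ^+ (p ^ j) = r ^+ (p ^ j).-1 * (r * a).
      have : (0 < p ^ j)%N by rewrite expn_gt0 (ltnW p_gt1).
      by case: (p ^ j)%N => // q _; rewrite exprS /=; ring.
    rewrite -!scalerA; apply: submodZ => //; exact: (Pa _ _ br 0%N).
  (* Otherwise [r], which is in [b] and so in [Q], would be in [P]: then [r ^+ 2] kills
     [iter k.+1 phi v] modulo [G], hence so does [r ^+ p], and [phi] would send [r *: iter k phi v]
     into [G]. *)
  have nQP : ~ subI Q P.
    move=> QP; apply: nG; apply: phiG; rewrite phiZ -iterS.
    have /PG'/(_ k.+1 r br 0%N) : P r by apply: QP; apply: br; apply/PsP.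
    rewrite /= scalerA -expr2 => h.
    have -> : r ^+ p = r ^+ (p - 2) * r ^+ 2 by rewrite -exprD subnK.
    by rewrite -scalerA; apply: submodZ.
  apply: (nchain Q hQ); exists (fun i => if (i <= n)%N then C i else Q); rewrite ltnn; split=> //.
  have [hC1 hC2] := hC.
  split=> i; first move=> _; first by case: (leqP i n) => [/hC1|_] //; apply: max_grann_prime hQ.
  rewrite ltnS => ile; rewrite ile; case: (leqP i.+1 n) => [ltin|]; first exact: hC2.
  by rewrite ltnS => nli; have -> : i = n; [apply/eqP; rewrite eqn_leq ile | rewrite CnP].
exists (c0 * c); first exact: WM.
by move=> t Tt; rewrite -scalerA; apply: (hc t Tt _ bc0 0%N).
Qed.

End FrobeniusModule.

(** * Parameter ideals and heights *)

Section GeneratedIdeals.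
Variable R : comNzRingType.
Implicit Types (I J K P Q : R -> Prop).
Local Notation gen := (idl (@zero_ideal R)).

Lemma ideal_gen_by (S : R -> Prop) : ideal_of (gen_by S).
Proof.
split=> [|x y [n [g [c [Sg ->]]]] [n' [g' [c' [Sg' ->]]]]|r x [n [g [c [Sg ->]]]]].
- by exists 0%N, (fun=> 0), (fun=> 0); split=> [[]|] //; rewrite big_ord0.
- exists (n + n')%N, (fun i => match split i with inl j => g j | inr j => g' j end),
    (fun i => match split i with inl j => c j | inr j => c' j end); split.
    by move=> i; case: (split i) => j; [apply: Sg | apply: Sg'].
  rewrite big_split_ord /=; congr (_ + _); apply: eq_bigr => i _.
    by rewrite (unsplitK (inl i)).
  by rewrite (unsplitK (inr i)).
- exists n, g, (fun i => r * c i); split=> //.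
  by rewrite mulr_sumr; apply: eq_bigr => i _; rewrite mulrA.
Qed.

Lemma gen_by_mem (S : R -> Prop) x : S x -> gen_by S x.
Proof.
by move=> Sx; exists 1%N, (fun=> x), (fun=> 1); split=> //; rewrite big_ord1 mul1r.
Qed.

Lemma gen_by_le (S K : R -> Prop) : ideal_of K -> (forall x, S x -> K x) -> subI (gen_by S) K.
Proof.
move=> hK SK x [n [g [c [Sg ->]]]]; apply: (ideal_sum _ hK) => i _.
by apply: ideal_mull => //; apply: SK.
Qed.

Lemma gen_famE n (g : 'I_n -> R) : gen_fam g = gen [seq g i | i <- enum 'I_n].
Proof.
apply: subI_anti.
  move=> x [c ->]; apply: (ideal_sum _ (@ideal_gen _ _)) => i _.
  apply: ideal_mull; first exact: ideal_gen.
  by apply: gen_mem; apply: map_f; rewrite mem_enum.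
apply: gen_le.
  split=> [|x y [c ->] [c' ->]|r x [c ->]].
  - by exists (fun=> 0); rewrite big1 // => i _; rewrite mul0r.
  - by exists (fun i => c i + c' i); rewrite -big_split; apply: eq_bigr => i _; rewrite mulrDl.
  - by exists (fun i => r * c i); rewrite mulr_sumr; apply: eq_bigr => i _; rewrite mulrA.
move=> _ /mapP[i _ ->]; exists (fun j => (j == i)%:R).
rewrite (bigD1 i) //= eqxx mul1r big1 ?addr0 // => j /negbTE ->; exact: mul0r.
Qed.

Lemma frob_pow_gen p n (s : seq R) : p \in [pchar R] ->
  frob_pow (gen s) (p ^ n) = gen (pows (p ^ n) s).
Proof.
move=> pP; apply: subI_anti.
  apply: gen_by_le; first exact: ideal_gen.
  by move=> _ [x [gx ->]]; apply: frob_gen.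
apply: gen_le; first exact: ideal_gen_by.
move=> _ /mapP[y ys ->]; apply: gen_by_mem; exists y; split=> //; exact: gen_mem.
Qed.

Lemma reg_nth J (s : seq R) : (forall i, (i < size s)%N -> nzd (idl J (take i s)) (nth 0 s i)) ->
  reg J s.
Proof.
elim: s J => //= y s IH J h; split; first exact: (h 0%N).
by apply: IH => i; apply: (h i.+1).
Qed.

Lemma reg_of_regular_seq d (a : 'I_d -> R) : regular_seq a ->
  reg (@zero_ideal R) [seq a i | i <- enum 'I_d].
Proof.
move=> ha; apply: reg_nth => i; rewrite size_map size_enum_ord => id r.
rewrite (nth_map (Ordinal id)) ?size_enum_ord // (nth_ord_enum (Ordinal id) (Ordinal id)).
have -> : gen (take i [seq a i | i <- enum 'I_d]) =
   gen_by (fun y => exists j : 'I_d, (j < Ordinal id)%N /\ y = a j); last exact: ha.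
apply: subI_anti.
  apply: gen_le; first exact: ideal_gen_by.
  move=> y; rewrite -map_take => /mapP[j jt ->]; apply: gen_by_mem; exists j; split=> //.
  have : val j \in take i (map val (enum 'I_d)) by rewrite -map_take; apply: map_f.
  by rewrite val_enum_ord take_iota mem_iota add0n => /andP[_ /leq_trans]; apply; apply: geq_minl.
apply: gen_by_le; first exact: ideal_gen.
move=> _ [j [ji ->]]; apply: gen_mem; rewrite -map_take; apply: map_f.
rewrite -(mem_map val_inj) map_take val_enum_ord take_iota mem_iota add0n leq_min.
by rewrite /= in ji; rewrite ji ltn_ord.
Qed.

(** No minimal prime contains an ideal of height at least 1, so coset avoidance meets no
    obstruction. With [x = 0] it gives an element of [I] in R°. *)
Lemma ideal_Rcirc_dense I x : noetherian R -> ideal_of I -> height_ge I 1 ->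
  exists2 y, I y & in_Rcirc (x + y).
Proof.
move=> noethR hI hgt.
have [Ps [Ps1 Ps2]] := minimal_primes noethR (@ideal_zero R).
have [y Iy yP] := coset_avoidance x (fun P PPs => (Ps1 P PPs).1) hI.
exists y => // P [hP minP] Pxy.
have [|Q QPs QP] := Ps2 P hP.
  by move=> _ ->; apply: ideal0; apply: prime_ideal_of.
have PQ := minP Q (Ps1 Q QPs).1 QP.
have [_ IQ] := yP Q QPs (PQ _ Pxy).
have [C [[hC sC] CP]] := hgt P hP (fun r Ir => QP _ (IQ r Ir)).
have [sub nsub] := sC 0%N isT.
apply: nsub => r /CP; apply: minP; first exact: hC.
by move=> z /sub /CP.
Qed.

Lemma height_ge1_of I c : I c -> in_Rcirc c -> height_ge I 1.
Proof.
move=> Ic hc Q hQ IQ.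
have : ~ minimal_prime Q by move=> /hc; apply; apply: IQ.
move=> /not_andP[//|/existsNP[P /not_implyP[hP /not_implyP[PQ nQP]]]].
exists (fun i => if i is 0%N then P else Q); split=> //; split=> [[|[]]|[|[]]] //.
Qed.

Lemma in_Rcirc1 : in_Rcirc (1 : R).
Proof. by move=> P [hP _]; apply: prime_not1. Qed.
Lemma in_RcircM (x y : R) : in_Rcirc x -> in_Rcirc y -> in_Rcirc (x * y).
Proof. by move=> hx hy P hP /(primeM hP.1)[]; [apply: hx | apply: hy]. Qed.
Lemma in_RcircX (x : R) n : in_Rcirc x -> in_Rcirc (x ^+ n).
Proof.
move=> hx; elim: n => [|n IH]; first exact: in_Rcirc1.
by rewrite exprS; apply: in_RcircM.
Qed.

Section Local.
Hypothesis noethR : noetherian R.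
Variable m : R -> Prop.
Hypothesis locm : local_ring m.

Lemma mprimary_sop d (a : 'I_d -> R) : sop m a -> mprimary m (gen [seq a i | i <- enum 'I_d]).
Proof. by move=> [_ h] x /h; rewrite gen_famE. Qed.

Lemma chain_sub_m n C i : prime_chain n C -> (i <= n)%N -> subI (C i) m.
Proof. by move=> [hC _] /hC; apply: prime_sub_m. Qed.

(** Here [e] bounds the dimension of R/J. An element of [m] outside every listed prime over [J] that
    does not contain [m] lowers it by one. *)
Lemma sop_extend e J : ideal_of J -> subI J m ->
  ~ (exists C, prime_chain e.+1 C /\ subI J (C 0%N)) ->
  exists y : seq R, [/\ size y = e, forall z, z \in y -> m z & mprimary m (idl J y)].
Proof.
elim: e J => [|e IH] J hJ Jm nC.
  exists [::]; split=> //; apply: mprimary_of_primes => // P hP JP.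
  apply: contrapT => nmP; apply: nC; exists (fun i => if i is 0%N then P else m).
  split=> //; split=> [[|i] _|[|//] _] //; first exact: prime_m.
  by split=> //; apply: prime_sub_m.
have [Ps [Ps1 Ps2]] := minimal_primes noethR hJ.
have [y my yP] := coset_avoidance 0 (fun P PPs => (Ps1 P PPs).1) (ideal_m locm).
rewrite add0r in yP.
have [|||ys [sys mys hys]] := IH (addgen J y).
- exact: ideal_addgen.
- by apply: addgen_le => //; apply: ideal_m.
- move=> [C [hC JC]]; have [hC1 hC2] := hC.
  have [|P PPs PC] := Ps2 (C 0%N) (hC1 0%N isT).
    by move=> x Jx; apply: JC; apply: addgen_base.
  have [hP JP] := Ps1 P PPs.
  apply: nC; exists (fun i => if i is k.+1 then C k else P); split=> //.
  split=> [[|i]|[|i]] //; [exact: hC1 | move=> _ | exact: hC2].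
  (* If [C 0] were inside [P], then [y] would be in [P], so [m] would lie in [P] and in [C 0],
     leaving no room for [C 1]. *)
  split=> // CP; have [_] := hC2 0%N isT; apply=> x /(chain_sub_m hC (isT : 1 <= e.+1)%N) mx.
  by apply: PC; apply: (yP P PPs _).2 => //; apply: CP; apply: JC; apply: addgen_gen.
exists (y :: ys); split=> //=; first by rewrite sys.
by move=> z; rewrite inE => /orP[/eqP->|/mys].
Qed.

End Local.

Lemma prime_chain_trunc n k (C : nat -> R -> Prop) : (k <= n)%N -> prime_chain n C -> prime_chain k C.
Proof.
move=> kn [h1 h2]; split=> i hi; [apply: h1 | apply: h2]; exact: leq_trans kn.
Qed.

Lemma prime_chain_cat n l (C C' : nat -> R -> Prop) : prime_chain n C -> prime_chain l C' ->
  C n = C' 0%N -> prime_chain (n + l) (fun i => if (i <= n)%N then C i else C' (i - n)%N).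
Proof.
move=> [h1 h2] [h3 h4] e; split=> i hi.
  case: leqP => [/h1 //|ni]; apply: h3; by rewrite leq_subLR.
have [lin|nin] := ltnP i n; first by rewrite (ltnW lin); apply: h2.
have -> : (if (i <= n)%N then C i else C' (i - n)%N) = C' (i - n)%N.
  case: leqP => // ni; have -> : i = n by apply/eqP; rewrite eqn_leq ni.
  by rewrite subnn.
rewrite subSn //; apply: h4; by rewrite ltn_subLR.
Qed.

End GeneratedIdeals.

(** * Parameter test elements *)

Section TestElements.
Variables (R : comNzRingType) (p : nat) (m : R -> Prop) (d : nat) (a : 'I_d -> R) (m0 : nat).
Hypothesis pP : p \in [pchar R].
Hypothesis noethR : noetherian R.
Hypothesis locm : local_ring m.
Hypothesis dimR : krull_dim_eq R d.
Hypothesis cmR : CM_local m d.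
Hypothesis sopa : sop m a.
Hypothesis hslm0 : HSL_number p a m0.

Local Notation gen := (idl (@zero_ideal R)).
Local Notation la := [seq a i | i <- enum 'I_d].
Local Notation Z := (cech_zero la).
Local Notation q0 := (p ^ m0)%N.

Lemma p_gt1 : (1 < p)%N. Proof. by case/andP: pP => /prime_gt1. Qed.

Lemma sop_mem (b : 'I_d -> R) : sop m b -> forall z, z \in [seq b i | i <- enum 'I_d] -> m z.
Proof. by move=> [h _] _ /mapP[i _ ->]. Qed.

Lemma size_fam T n (b : 'I_n -> T) : size [seq b i | i <- enum 'I_n] = n.
Proof. by rewrite size_map size_enum_ord. Qed.

Lemma la_m z : z \in la -> m z. Proof. exact: sop_mem. Qed.
Lemma la_mprimary : mprimary m (gen la). Proof. exact: mprimary_sop. Qed.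

(** The Cohen-Macaulay hypothesis supplies one regular system of parameters; the exchange argument
    carries regularity over to [a]. *)
Lemma la_reg : reg (@zero_ideal R) la.
Proof.
have [b [sopb regb]] := cmR.
have [||||||//] := link_sop noethR locm pP (a := [::]) (x := [seq b i | i <- enum 'I_d]) (s := la).
- by rewrite !size_fam.
- exact: sop_mem.
- exact: la_m.
- exact: reg_of_regular_seq.
- exact: mprimary_sop.
- exact: la_mprimary.
Qed.

Definition rep_poly (h : R * nat) : {poly R} := h.1 *: 'X^(h.2).
Definition Gamma (f : {poly R}) := exists n, Z (f ^+ (p ^ n)).

Let subZ : submod Z := submod_cech_zero la.

Lemma AprodE : Aprod a = \prod_(y <- la) y. Proof. by rewrite big_map big_enum. Qed.

Lemma hzeroP h : hzero a h <-> Z (rep_poly h).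
Proof.
case: h => r j; rewrite /hzero /rep_poly AprodE /=; set A := \prod_(y <- la) y.
split=> [[k [l [s h]]]|[K [sK hK]]].
  exists (k + l + j)%N; split.
    by rewrite (leq_trans (size_scale_leq _ _)) // size_polyXn ltnS leq_addl.
  rewrite cech_eval_mono ?ltnS ?leq_addl // -/A.
  have -> : ((k + l + j).+1 - j = k + l + 1)%N by rewrite -addSn addnK addn1.
  have e : r * A ^+ (k + l) = A ^+ (j + l) * \sum_(i < d) s i * a i ^+ k.
    move: h; set S := \sum_(i < d) _ => h.
    by apply/eqP; rewrite -subr_eq0; apply/eqP; rewrite -[RHS]h !exprD; ring.
  rewrite exprD mulrA e expr1 mulrAC -exprSr.
  have -> : (k + l + j).+1 = (k + (j + l).+1)%N by rewrite addnS -addnA (addnC l).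
  apply: gen_prod; apply: (ideal_sum _ (@ideal_gen _ _)) => i _.
  apply: ideal_mull; first exact: ideal_gen.
  by apply: gen_mem; apply: mem_pows; apply: map_f; rewrite mem_enum.
(* For [r = 0] the polynomial vanishes and its size says nothing about [j]. *)
have [->|nr] := eqVneq r 0.
  exists 0%N, 0%N, (fun=> 0); rewrite big1 => [|i _]; last by rewrite mul0r.
  by rewrite !mul0r subrr mulr0.
have jK : (j < K.+1)%N.
  rewrite ltnNge; apply/negP => Kj; case/eqP: nr.
  by have := nth_default 0 (leq_trans sK Kj); rewrite coefZ coefXn eqxx mulr1.
rewrite cech_eval_mono // in hK.
have : gen_fam (fun i => a i ^+ K.+1) (r * A ^+ (K.+1 - j)).
  by rewrite gen_famE; move: hK; rewrite /pows -map_comp.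
move=> [s hs]; exists K.+1, 0%N, s.
rewrite -hs expr0 mul1r -mulrA -exprD subnK ?subrr //; exact: ltnW.
Qed.

Lemma rep_poly_hxn n h : rep_poly (hxn p n h) = rep_poly h ^+ (p ^ n).
Proof.
elim: n => [|n IH]; first by rewrite expr1.
rewrite expnSr exprM -IH /hxn iterS -/(hxn p n h) /rep_poly /hx /=.
by rewrite exprZn -exprM.
Qed.

Lemma gamma_xP h : gamma_x p a h <-> Gamma (rep_poly h).
Proof. by split=> [] [n hn]; exists n; move: hn; rewrite hzeroP rep_poly_hxn. Qed.

Lemma rep_poly_surj f : exists h, Z (f - rep_poly h).
Proof. by have [r [j h]] := cech_reduceE la f; exists (r, j.+1). Qed.

Lemma polyD n (f g : {poly R}) : (f + g) ^+ (p ^ n) = f ^+ (p ^ n) + g ^+ (p ^ n).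
Proof. by apply: expD; apply: poly_pchar. Qed.
Lemma polyB n (f g : {poly R}) : (f - g) ^+ (p ^ n) = f ^+ (p ^ n) - g ^+ (p ^ n).
Proof. by apply: expB; apply: poly_pchar. Qed.
Lemma Z_frob n f : Z f -> Z (f ^+ (p ^ n)). Proof. exact: cech_zero_frob. Qed.

Lemma Gamma_of_frob n f : Gamma (f ^+ (p ^ n)) -> Gamma f.
Proof. by move=> [k h]; exists (n + k)%N; rewrite expnD exprM. Qed.
Lemma Gamma_of_Z f : Z f -> Gamma f. Proof. by exists 0%N; rewrite expr1. Qed.

Lemma iter_frob n (f : {poly R}) : iter n (fun g => g ^+ p) f = f ^+ (p ^ n).
Proof. by elim: n => [|n IH] /=; rewrite ?expr1 // IH -exprM expnSr. Qed.

Lemma Gamma_torsion_free : torsion_free_quot (fun f : {poly R} => f ^+ p) Z Gamma.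
Proof.
split; last exact: Gamma_of_Z.
- split=> [|f g [k hk] [l hl]|r f [k hk]].
  + by apply: Gamma_of_Z; apply: submod0.
  + exists (k + l)%N; rewrite polyD; apply: submodD => //.
      by rewrite expnD exprM; apply: Z_frob.
    by rewrite addnC expnD exprM; apply: Z_frob.
  + by exists k; rewrite exprZn; apply: submodZ.
- move=> f [k hk]; exists k; rewrite -exprM mulnC exprM -[X in _ ^+ X]expn1; exact: Z_frob.
- by move=> f; rewrite -[X in _ ^+ X]expn1; apply: Gamma_of_frob.
Qed.

Let subG : submod Gamma. Proof. by case: Gamma_torsion_free. Qed.

Lemma Gamma_frob n f : Gamma f -> Gamma (f ^+ (p ^ n)).
Proof.
move=> [k hk]; exists k; rewrite -exprM mulnC exprM; exact: Z_frob.
Qed.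

Lemma Gamma_of_frob_scale n r f : Gamma (r *: f ^+ (p ^ n)) -> Gamma (r *: f).
Proof.
move=> h; apply: (@Gamma_of_frob n); rewrite exprZn.
have -> : r ^+ (p ^ n) = r ^+ (p ^ n).-1 * r by rewrite -exprSr prednK ?(p_gt0 pP).
by rewrite -scalerA; apply: submodZ.
Qed.

Lemma Gamma_HSL f : Gamma f -> Z (f ^+ q0).
Proof.
move=> Gf; have [h hf] := rep_poly_surj f.
apply: (submod_diff subZ (v := rep_poly h ^+ q0)); first by rewrite -polyB; apply: Z_frob.
rewrite -rep_poly_hxn; apply/hzeroP; apply: hslm0.1; apply/gamma_xP.
by apply: (submod_diffr subG (u := f)) => //; apply: Gamma_of_Z.
Qed.

(** The set T of the overview. All [n] may be required, not only large ones, because membership in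
    [Gamma] descends along Frobenius by [Gamma_of_frob_scale]. *)
Definition tight_zero (f : {poly R}) :=
  exists2 c, in_Rcirc c & forall n, Gamma (c *: f ^+ (p ^ n)).

Lemma tight_zero_Gamma f : Gamma f -> tight_zero f.
Proof.
by move=> Gf; exists 1 => [|n]; [exact: in_Rcirc1 | rewrite scale1r; apply: Gamma_frob].
Qed.

Lemma submod_tight_zero : submod tight_zero.
Proof.
split=> [|f g [c hc hf] [c' hc' hg]|r f [c hc hf]].
- by apply: tight_zero_Gamma; apply: submod0.
- exists (c * c') => [|n]; first exact: in_RcircM.
  rewrite polyD scalerDr; apply: submodD => //; last by rewrite -scalerA; apply: submodZ.
  by rewrite mulrC -scalerA; apply: submodZ.
- exists c => // n; rewrite exprZn scalerA mulrC -scalerA; exact: submodZ.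
Qed.

Lemma tight_zero_frob n f : tight_zero f -> tight_zero (f ^+ (p ^ n)).
Proof. by move=> [c hc hf]; exists c => // k; rewrite -exprM -expnD. Qed.

Definition test_ideal r := forall f, tight_zero f -> Gamma (r *: f).

Lemma ideal_test_ideal : ideal_of test_ideal.
Proof.
split=> [f _|r s hr hs f hf|s r hr f hf].
- by rewrite scale0r; apply: submod0.
- by rewrite scalerDl; apply: submodD => //; [apply: hr | apply: hs].
- by rewrite -scalerA; apply: submodZ => //; apply: hr.
Qed.

Lemma test_ideal_Rcirc : exists2 c, test_ideal c & in_Rcirc c.
Proof.
(* The counter starts at [d.+1], since no chain of primes in R has that length. *)
have [||||||||c hc h] := @uniform_annihilator_step R {poly R} p (fun f => f ^+ p) p_gt1 _ _ noethR
  Z tight_zero (@in_Rcirc R) _ submod_tight_zero _ _ _ d.+1 Gamma Gamma_torsion_free.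
- by move=> f g; rewrite -[in LHS](expn1 p) polyD expn1.
- by move=> r f; rewrite exprZn.
- exact: (cech_artin pP noethR locm la_m la_reg la_mprimary).
- by move=> f; rewrite -[X in _ ^+ X]expn1; apply: tight_zero_frob.
- exact: in_Rcirc1.
- exact: in_RcircM.
- by move=> f [c hc hf]; exists c => // n; rewrite iter_frob.
- by move=> P _ [C [hC _]]; apply: dimR.2; exists C.
by exists c.
Qed.

Lemma test_ideal_height : height_ge test_ideal 1.
Proof. by have [c hc hR] := test_ideal_Rcirc; apply: height_ge1_of hR. Qed.

Lemma rep_poly_hadd h h' : Z (rep_poly h + rep_poly h' - rep_poly (hadd a h h')).
Proof.
rewrite /rep_poly /hadd AprodE /= scalerDl opprD addrACA.
apply: submodD => //; first exact: cech_shift.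
by rewrite addnC; apply: cech_shift.
Qed.

Lemma rep_poly_hopp h : rep_poly (hopp h) = - rep_poly h.
Proof. by rewrite /rep_poly /= scaleNr. Qed.
Lemma rep_poly_hscale r h : rep_poly (hscale r h) = r *: rep_poly h.
Proof. by rewrite /rep_poly /= scalerA. Qed.

Lemma test_ideal_special : G_special p a test_ideal.
Proof.
have subT := submod_tight_zero.
have TZ f : Z f -> tight_zero f by move=> Zf; apply: tight_zero_Gamma; apply: Gamma_of_Z.
exists (fun h => tight_zero (rep_poly h)); split.
  split.
  - move=> h h' /gamma_xP e Th; apply: (submod_diffr subT _ Th); apply: tight_zero_Gamma.
    apply: (submod_diff subG _ e); apply: Gamma_of_Z.
    by have := rep_poly_hadd h (hopp h'); rewrite rep_poly_hopp.
  - by rewrite /rep_poly scale0r; apply: submod0.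
  - move=> h h' Th Th'; apply: (submod_diffr subT (TZ _ (rep_poly_hadd h h'))).
    exact: submodD.
  - by move=> r h Th; rewrite rep_poly_hscale; apply: submodZ.
  - by move=> h Th; rewrite -[hx p h]/(hxn p 1 h) rep_poly_hxn; apply: tight_zero_frob.
move=> n r; split=> [hr h Th|hr f Tf].
  apply/gamma_xP; rewrite rep_poly_hscale rep_poly_hxn; apply: hr; exact: tight_zero_frob.
have [h hf] := rep_poly_surj f.
have Th : tight_zero (rep_poly h) by apply: (submod_diffr subT (u := f)) => //; apply: TZ.
apply: (submod_diff subG (v := r *: rep_poly h)).
  by rewrite -scalerBr; apply: submodZ => //; apply: Gamma_of_Z.
have := hr h Th; rewrite /gzero gamma_xP rep_poly_hscale rep_poly_hxn.
exact: Gamma_of_frob_scale.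
Qed.

(** An element of R° in [c] kills all x^n N modulo [Gamma], which places N inside T. *)
Lemma test_ideal_least c : G_special p a c -> height_ge c 1 -> subI test_ideal c.
Proof.
move=> [N [hN cN]] hgt r hr.
have idc : ideal_of c.
  split=> [|x y cx cy|s x cx].
  - by apply/(cN 0%N) => h _; apply/gamma_xP; rewrite rep_poly_hscale scale0r; apply: submod0.
  - apply/(cN 0%N) => h Nh; apply/gamma_xP; rewrite rep_poly_hscale scalerDl.
    by apply: submodD => //; rewrite -rep_poly_hscale; apply/gamma_xP; apply: (cN 0%N _).1.
  - apply/(cN 0%N) => h Nh; apply/gamma_xP; rewrite rep_poly_hscale -scalerA.
    by apply: submodZ => //; rewrite -rep_poly_hscale; apply/gamma_xP; apply: (cN 0%N _).1.
have [c0 cc0 hc0] := ideal_Rcirc_dense 0 noethR idc hgt; rewrite add0r in hc0.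
apply/(cN 0%N) => h Nh; apply/gamma_xP; rewrite rep_poly_hscale; apply: hr.
exists c0 => // n; rewrite -rep_poly_hxn -rep_poly_hscale; apply/gamma_xP.
exact: (cN n c0).1.
Qed.

Lemma cech_zero_frob_mono r c j n :
  Z (c *: (r *: 'X^(j.+1)) ^+ (p ^ n)) <-> gen (pows (p ^ n) (pows j.+1 la)) (c * r ^+ (p ^ n)).
Proof.
have e : (j.+1 * p ^ n = (j.+1 * p ^ n).-1.+1)%N by rewrite prednK // muln_gt0 (p_gt0 pP).
rewrite exprZn scalerA -exprM e (cech_zero_mono pP noethR locm la_m la_reg).
by rewrite -e -pows_comp.
Qed.

(** The origin of the exponent [q0]: applying x^(m_0) kills [Gamma] and raises the coefficient to
    the power [q0]. *)
Lemma HSL_scale c k f : Gamma (c *: f ^+ (p ^ k)) -> Z (c ^+ q0 *: f ^+ (p ^ (k + m0))).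
Proof. by move=> /Gamma_HSL; rewrite exprZn -exprM -expnD. Qed.

Lemma sop_test (s : seq R) c r c0 N : size s = d -> (forall z, z \in s -> m z) ->
  mprimary m (gen s) -> test_ideal c -> in_Rcirc c0 ->
  (forall n, (N <= n)%N -> gen (pows (p ^ n) s) (c0 * r ^+ (p ^ n))) ->
  forall n, (m0 <= n)%N -> gen (pows (p ^ n) s) (c ^+ q0 * r ^+ (p ^ n)).
Proof.
move=> sd sm smp hc hc0 hN n hn.
have [||||||_ [K [D lk]]] := link_sop noethR locm pP (a := [::]) (x := la) (s := s).
- by rewrite size_fam.
- exact: la_m.
- exact: sm.
- exact: la_reg.
- exact: la_mprimary.
- exact: smp.
(* By the link, the vanishing of c_1 x^k [D r / A^(K+1)] in H is exactly the membership of c_1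
   r^(p^k) in (s^(p^k)). *)
pose f : {poly R} := (D * r) *: 'X^(K.+1).
have ZE k c1 : Z (c1 *: f ^+ (p ^ k)) <-> gen (pows (p ^ k) s) (c1 * r ^+ (p ^ k)).
  rewrite cech_zero_frob_mono exprMn mulrCA; symmetry; exact: lk.
have Tf : tight_zero f.
  exists c0 => // k; apply: (@Gamma_of_frob_scale N); apply: Gamma_of_Z.
  by rewrite -exprM -expnD; apply/ZE/hN; apply: leq_addl.
apply/ZE; rewrite -(subnK hn); apply: HSL_scale; apply: hc; exact: tight_zero_frob.
Qed.

Lemma test_ideal_weak_ptest c : test_ideal c -> in_Rcirc c -> weak_ptest p m0 (c ^+ q0).
Proof.
move=> hc hcR; split; first exact: in_RcircX.
move=> I [idI nI1 [n [[hge nhge] [g gI]]]] r; split; last first.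
  by move=> h; exists (c ^+ q0); split; [exact: in_RcircX | exists m0].
move=> [c0 [hc0 [N hN]]] k hk.
set lg := [seq g i | i <- enum 'I_n].
have Ig : I = gen lg by rewrite -gen_famE; apply/predeqP.
have Im : subI I m by apply: proper_sub_m.
have lgm z : z \in lg -> m z by move=> zl; apply: Im; rewrite Ig; apply: gen_mem.
have nd : (n <= d)%N.
  rewrite leqNgt; apply/negP => dn; have [C [hC _]] := hge m (prime_m locm) Im.
  by apply: dimR.2; exists C; apply: prime_chain_trunc hC.
(* A chain of length d-n+1 over [I] would prolong the chain of length n below its first prime to one
   of length d+1. *)
have [|y [sy my hy]] := sop_extend noethR locm (e := (d - n)%N) idI Im.
  move=> [C [hC IC]]; have [C' [hC' e']] := hge (C 0%N) (hC.1 0%N isT) IC.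
  apply: dimR.2; have e : (n + (d - n).+1 = d.+1)%N by rewrite addnS subnKC.
  by rewrite -e; eexists; apply: prime_chain_cat hC' hC _; apply/predeqP.
have fI j : frob_pow I (p ^ j) = gen (pows (p ^ j) lg) by rewrite Ig frob_pow_gen.
rewrite fI; apply: (krull_intersection noethR locm (s := pows (p ^ k) y)).
- exact: ideal_gen.
- by move=> z; rewrite -(prednK (p_gt0 pP k)); apply: (pows_m locm).
(* The test is applied to the system of [lg] and the [j.+1]-th powers of [y]: the exponent is
   positive, so they stay in [m], and at least [j], as Krull's theorem demands. *)
move=> j; have := @sop_test (lg ++ pows j.+1 y) c r c0 N.
move=> /(_ _ _ _ hc hc0 _ k hk) h.
apply: (gen_le (s := pows (p ^ k) (lg ++ pows j.+1 y))).
- by apply: ideal_idl; apply: ideal_gen.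
- move=> z; rewrite pows_cat mem_cat => /orP[zl|].
    by apply: idl_base; [exact: ideal_gen | exact: gen_mem].
  move=> /mapP[_ /mapP[w wy ->] ->].
  rewrite -exprM mulnC exprM exprS; apply: ideal_mull; first by apply: ideal_idl; apply: ideal_gen.
  apply: idl_gen; first exact: ideal_gen.
  by apply: (map_f (fun z => z ^+ j)); apply: mem_pows.
apply: h.
- by rewrite size_cat [size (pows _ _)]size_map sy size_fam subnKC.
- move=> z; rewrite mem_cat => /orP[/lgm //|]; exact: (pows_m locm).
- rewrite Ig -idl_cat in hy; apply: (mprimary_gen noethR (@ideal_gen _ _) hy) => z.
  rewrite mem_cat => /orP[zl|zy].
    by exists 1%N; rewrite expr1; apply: gen_mem; rewrite mem_cat zl.
  by exists j.+1; apply: gen_mem; rewrite mem_cat mem_pows ?orbT.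
move=> l /hN; rewrite fI pows_cat; apply: idl_mono; first exact: ideal_zero.
by move=> z zl; rewrite mem_cat zl.
Qed.

Lemma parameter_ideal_la j : parameter_ideal (gen (pows j.+1 la)).
Proof.
have lam := pows_m locm (k := j) la_m.
have hm : subI (gen (pows j.+1 la)) m by apply: gen_le; [exact: (ideal_m locm) |].
split; first exact: ideal_gen.
  by move=> /hm; apply: (m_not1 locm).
exists d; split; last first.
  exists (fun i => a i ^+ j.+1) => x; rewrite gen_famE.
  by rewrite /pows -map_comp.
split=> [Q hQ gQ|]; last first.
  by move=> /(_ m (prime_m locm) hm)[C [hC _]]; apply: dimR.2; exists C.
have mQ : Q = m.
  apply: subI_anti; first exact: prime_sub_m.
  exact: (mprimary_prime (mprimary_pows noethR la_mprimary j.+1)).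
(* Only the top of a longest chain is changed, to [m], the sole prime over the ideal. *)
have [[C hC] _] := dimR; exists (fun i => if (i < d)%N then C i else m).
rewrite ltnn mQ; split=> //; have [hC1 hC2] := hC; split=> i hi.
  by case: ifP => _; [exact: hC1 | exact: prime_m].
rewrite hi; case: ifP => [id|_]; first exact: hC2.
split; first by apply: prime_sub_m => //; apply: hC1; apply: ltnW.
move=> mC; apply: (hC2 i hi).2 => x /(chain_sub_m locm hC hi); exact: mC.
Qed.

(** A class r/A^(j+1) of T makes [r] an element of the tight closure of (a^(j+1)). The test at the
    single exponent [w] kills c x^w of the class, which descends to c times the class in [Gamma]. *)
Lemma weak_ptest_test_ideal w c : weak_ptest p w c -> test_ideal c.
Proof.
move=> [hcR hc] f Tf.
have [r [j hf]] := cech_reduceE la f.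
have Tr : tight_zero (r *: 'X^(j.+1)).
  apply: (submod_diffr submod_tight_zero (u := f)) => //.
  by apply: tight_zero_Gamma; apply: Gamma_of_Z.
apply: (submod_diff subG (v := c *: (r *: 'X^(j.+1)))).
  by rewrite -scalerBr; apply: submodZ => //; apply: Gamma_of_Z.
have fpE n : frob_pow (gen (pows j.+1 la)) (p ^ n) = gen (pows (p ^ n) (pows j.+1 la)).
  exact: frob_pow_gen.
have : tight_closure p (gen (pows j.+1 la)) r.
  have [c0 hc0 h0] := Tr; exists (c0 ^+ q0); split; first exact: in_RcircX.
  exists m0 => n hn; rewrite fpE; apply/cech_zero_frob_mono.
  by rewrite -(subnK hn); apply: HSL_scale.
move/(hc _ (parameter_ideal_la j) r)/(_ w (leqnn w)); rewrite fpE => /cech_zero_frob_mono h.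
by apply: (@Gamma_of_frob_scale w); apply: Gamma_of_Z.
Qed.

Lemma frob_pow_test_ideal_sub : subI (frob_pow test_ideal q0) (@weak_param_test_ideal R p).
Proof.
have [c hc hcR] := test_ideal_Rcirc.
have sub c' : test_ideal c' -> in_Rcirc c' -> weak_param_test_ideal p (c' ^+ q0).
  by move=> h1 h2; apply: gen_by_mem; right; exists m0; apply: test_ideal_weak_ptest.
apply: gen_by_le; first exact: ideal_gen_by.
move=> _ [x [hx ->]].
have idT := ideal_test_ideal.
(* [x] itself may lie in a minimal prime; a multiple [y] of [c] moves it into R°, and both [x + y]
   and [y] remain in the test ideal. *)
have [||y [u uy] hxy] := ideal_Rcirc_dense (I := addgen (@zero_ideal R) c) x noethR.
- exact: ideal_addgen (@ideal_zero R).
- by apply: height_ge1_of hcR; apply: addgen_gen (@ideal_zero R).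
have {}uy : y = u * c by apply/eqP; rewrite -subr_eq0; apply/eqP.
have Ty : test_ideal y by rewrite uy; exact: (ideal_mull u idT hc).
rewrite -(addrK y x) (expB pP); apply: idealB; first exact: ideal_gen_by.
  by apply: sub => //; exact: (idealD idT hx Ty).
rewrite uy exprMn; apply: ideal_mull; first exact: ideal_gen_by.
exact: sub.
Qed.

Lemma weak_param_test_ideal_sub : subI (@weak_param_test_ideal R p) test_ideal.
Proof.
apply: gen_by_le; first exact: ideal_test_ideal.
move=> c [->|[w]]; last exact: weak_ptest_test_ideal.
exact: ideal0 ideal_test_ideal.
Qed.

End TestElements.

Unset Implicit Arguments. Set Strict Implicit.

Theorem theorem4p5 (R : comNzRingType) (p : nat) (m : R -> Prop) (d : nat)
    (a : 'I_d -> R) (m0 : nat) :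
  prime p -> p \in [pchar R] -> noetherian R -> local_ring m ->
  krull_dim_eq R d -> (0 < d)%N -> CM_local m d ->
  sop m a -> HSL_number p a m0 ->
  exists b : R -> Prop,
    [/\ G_special p a b, height_ge b 1 &
        (forall c, G_special p a c -> height_ge c 1 -> subI b c)] /\
    (forall c, b c -> in_Rcirc c -> weak_ptest p m0 (c ^+ (p ^ m0))) /\
    (exists c : R, weak_ptest p m0 c) /\
    subI (frob_pow b (p ^ m0)) (@weak_param_test_ideal R p) /\
    subI (@weak_param_test_ideal R p) b.
Proof.
move=> _ pP noethR locm dimR _ cmR sopa hsl.
have testP := test_ideal_weak_ptest pP noethR locm dimR cmR sopa hsl.
exists (test_ideal p a); split; first split.
- exact: test_ideal_special.
- exact: (test_ideal_height pP noethR locm dimR cmR sopa).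
- by move=> c; apply: test_ideal_least.
split; first by move=> c; apply: testP.
split.
  have [c hc hcR] := test_ideal_Rcirc pP noethR locm dimR cmR sopa.
  by exists (c ^+ (p ^ m0)); apply: testP.
split; first exact: (frob_pow_test_ideal_sub pP noethR locm dimR cmR sopa hsl).
exact: (weak_param_test_ideal_sub pP noethR locm dimR cmR sopa hsl).
Qed.
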